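(* Let $X_1,X_2,\ldots$ be i.i.d. nondegenerate real random variables with mean zero and finite variance, and let $S_n=\sum_{k=1}^n X_k$. Let $f(n)$, $n\ge1$, be any increasing positive sequence. Then: (I) The condition $$\sum_{n=1}^\infty n^{-3/2}f(n)<\infty$$ is necessary and sufficient for the existence of an integer $n_f$ such that $$\inf_{n\ge n_f}\sqrt{n}\;\mathbf{P}\big(S_k\ge f(k)\ \text{for } n_f\le k\le n\big)>0 .$$ (II) The same condition $\sum_{n=1}^\infty n^{-3/2}f(n)<\infty$ is necessary and sufficient for $$\sup_{n\ge1}\sqrt{n}\;\mathbf{P}\big(S_k\ge -f(k)\ \text{for } 1\le k\le n\big)<\infty .$$ *)

(* Defs.v *)
From HB Require Import structures.
From mathcomp Require Import all_boot all_order all_algebra.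
From mathcomp Require Import all_classical all_reals all_analysis.

Set Implicit Arguments.
Unset Strict Implicit.
Unset Printing Implicit Defensive.

Import Order.TTheory GRing.Theory Num.Theory.
Import numFieldNormedType.Exports.

Local Open Scope classical_set_scope.
Local Open Scope ring_scope.
Local Open Scope ereal_scope.

(* Sequences of random variables are indexed from 0: [X k] stands for
   X_{k+1}, so that S_n = X_1 + ... + X_n is the sum of [X k] over k < n. *)

Definition mutually_independent (d : measure_display) (T : measurableType d)
    (R : realType) (P : probability T R) (X : nat -> {RV P >-> R}) : Prop :=
  forall (J : seq nat) (B : nat -> set R), uniq J ->
    (forall k, measurable (B k)) ->
    P [set w | forall k, k \in J -> B k (X k w)] =
    \prod_(k <- J) P (X k @^-1` B k).

Definition identically_distributed (d : measure_display)
    (T : measurableType d) (R : realType) (P : probability T R)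
    (X : nat -> {RV P >-> R}) : Prop :=
  forall (i j : nat) (B : set R), measurable B ->
    distribution P (X i) B = distribution P (X j) B.

Definition iid (d : measure_display) (T : measurableType d)
    (R : realType) (P : probability T R) (X : nat -> {RV P >-> R}) : Prop :=
  mutually_independent X /\ identically_distributed X.

Definition nondegenerate_rv (d : measure_display) (T : measurableType d)
    (R : realType) (P : probability T R) (Y : {RV P >-> R}) : Prop :=
  ~ exists c : R, {ae P, forall w, Y w = c}.

Definition walk (d : measure_display) (T : measurableType d)
    (R : realType) (P : probability T R) (X : nat -> {RV P >-> R})
    (n : nat) (w : T) : R :=
  (\sum_(k < n) X k w)%R.

(* Only the values f n with n >= 1 matter. "Increasing" is read in the wide
   sense. *)
Definition positive_increasing (R : realType) (f : nat -> R) : Prop :=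
  (forall n, (1 <= n)%N -> (0 < f n)%R) /\
  (forall m n, (1 <= m)%N -> (m <= n)%N -> (f m <= f n)%R).

(* Main.v *)
(* Along the walk stopped at the boundary, the proof follows the functionals
   W_n = E[h(S_n - b_n); S_k >= b_k for k <= n] with b = f or b = - f. For
   h = x^+, which is convex, W_n can only decrease through an increase of the
   boundary. For an upper bound one takes an explicit function h that vanishes
   on the negative half-line, is at least x, is Lipschitz on [0, +oo[, and is
   superharmonic for the killed walk; its existence only uses the finiteness of
   the second moment. Harris' inequality and E S_n^+ >= c sqrt n give
   P(S_k >= b_k for k <= n) <= C W_n / sqrt n, so that the moving boundary
   multiplies W_n by a factor 1 +- O((f(n+1) - f(n)) / sqrt n). By Abel
   summation, sum (f(n+1) - f(n)) / sqrt n and sum n^(-3/2) f(n) converge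
   simultaneously, which yields the sufficiency of the condition; lower bounds
   on probabilities come from W_n and from
   E[S_n^2; S_k >= b_k for k <= n] = O(sqrt n). Conversely, if the probabilities
   are of exact order 1 / sqrt n, each increment of f changes W_n by at least a
   constant times (f(n+1) - f(n)) / sqrt n, while W_n stays bounded. *)

Require Import Defs.
From HB Require Import structures.
From mathcomp Require Import all_boot all_order all_algebra.
From mathcomp Require Import all_classical all_reals all_analysis.
From mathcomp Require Import measurable_realfun ring lra.

Set Implicit Arguments.
Unset Strict Implicit.
Unset Printing Implicit Defensive.

Import Order.TTheory GRing.Theory Num.Theory.
Import numFieldNormedType.Exports.

Local Open Scope classical_set_scope.
Local Open Scope ring_scope.

(** * Averages over one step of the walk *)

(** All expectations are taken under the law [mu] of one step. [stay] pulls the test function back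
    one step at a time, so induction on [n] over all test functions replaces conditioning, and
    independence enters only in [integral_stay]. Averages over one step keep nonnegative
    nondecreasing functions so, which is why Harris' inequality can be proved step by step.

    The obstacle is that only a second moment is available. At each step x^+ gains the expected
    overshoot below the origin. A concave corrector has to pay for this gain; the natural one is
    cubic in the overshoot and becomes integrable only after its value at the origin is subtracted.

    Three of the four implications also need f(n) = O(sqrt n). If the series converges, monotonicity
    over a dyadic block gives it. In the converse of (I) it comes from
    E[S_n^2; S_k >= 0 for k <= n], and in the converse of (II) from Harris' inequality at a time of
    order f(n)^2. In the converse of (I) the constant obtained may be too large for the free walk to
    exceed the barrier, so the barrier is first multiplied by a small [eps]. *)

Section Averages.
Context (R : realType) (mu : probability R R).

Definition avg (g : R -> R) : R := \int[mu]_z g z.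

(** Quadratic growth is what a finite second moment integrates. Linear growth is kept as a separate
    class because association inequalities multiply two functions. *)
Definition quad_growth (g : R -> R) :=
  measurable_fun setT g /\ exists C, forall x, `|g x| <= C * (1 + x ^+ 2).

Definition lin_growth (g : R -> R) :=
  measurable_fun setT g /\ exists C, forall x, `|g x| <= C * (1 + `|x|).

Lemma lin_quad g : lin_growth g -> quad_growth g.
Proof.
move=> [mg [C Cg]]; split=> //; exists (2 * C) => x.
have C0 : 0 <= C by have := Cg 0; rewrite normr0 addr0 mulr1; exact: le_trans.
apply: (le_trans (Cg x)).
have : `|x| <= 1 + x ^+ 2 by rewrite -real_normK ?num_real//; nra.
have : 0 <= x ^+ 2 by exact: sqr_ge0.
nra.
Qed.

Lemma quad_growthD g g' : quad_growth g -> quad_growth g' ->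
  quad_growth (fun x => g x + g' x).
Proof.
move=> [mg [C Cg]] [mg' [C' Cg']]; split; first exact: measurable_funD.
exists (C + C') => x; rewrite mulrDl.
exact: le_trans (ler_normD _ _) (lerD (Cg x) (Cg' x)).
Qed.

Lemma quad_growthZ a g : quad_growth g -> quad_growth (fun x => a * g x).
Proof.
move=> [mg [C Cg]]; split; first by apply: measurable_funM => //.
by exists (`|a| * C) => x; rewrite normrM -mulrA ler_wpM2l.
Qed.

Lemma lin_growthM g g' : lin_growth g -> lin_growth g' ->
  quad_growth (fun x => g x * g' x).
Proof.
move=> [mg [C Cg]] [mg' [C' Cg']]; split; first exact: measurable_funM.
exists (2 * (C * C')) => x; rewrite normrM.
apply: (le_trans (ler_pM _ _ (Cg x) (Cg' x))) => //.
have C0 : 0 <= C by have := Cg 0; rewrite normr0 addr0 mulr1; exact: le_trans.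
have C'0 : 0 <= C' by have := Cg' 0; rewrite normr0 addr0 mulr1; exact: le_trans.
have CC := mulr_ge0 C0 C'0.
have E : (1 + `|x|) * (1 + `|x|) <= 2 * (1 + x ^+ 2).
  rewrite -real_normK ?num_real//; have := sqr_ge0 (`|x| - 1); nra.
have := ler_wpM2l CC E; lra.
Qed.

Lemma nondecreasing_meas (g : R -> R) :
  {homo g : x y / x <= y} -> measurable_fun setT g.
Proof. by move=> g_ndecr; apply: nondecreasing_measurable. Qed.

Lemma lin_growth_cst c : lin_growth (fun=> c).
Proof.
by split=> //; exists `|c| => x; rewrite ler_peMr// lerDl.
Qed.

Lemma lin_growth_id : lin_growth id.
Proof. by split=> //; exists 1 => x; rewrite mul1r lerDr. Qed.

Lemma quad_growth_sq : quad_growth (fun x => x ^+ 2).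
Proof.
split; first exact: measurable_funX.
by exists 1 => x; rewrite mul1r ger0_norm ?sqr_ge0// lerDr.
Qed.

Lemma lin_growth_shift c g : lin_growth g -> lin_growth (fun x => g (x + c)).
Proof.
move=> [mg [C Cg]]; split.
  by apply: measurableT_comp => //; exact: measurable_funD.
exists (C * (1 + `|c|)) => x.
have C0 : 0 <= C by have := Cg 0; rewrite normr0 addr0 mulr1; exact: le_trans.
apply: (le_trans (Cg _)); rewrite -mulrA ler_wpM2l//.
have := ler_normD x c; have := normr_ge0 x; have := normr_ge0 c; nra.
Qed.

Context (sq_int : mu.-integrable setT (EFin \o (fun z : R => z ^+ 2))).

Lemma quad_growth_integrable g :
  quad_growth g -> mu.-integrable setT (EFin \o g).
Proof.
move=> [mg [C Cg]].
have h1 : mu.-integrable setT (EFin \o (fun x => C * (1 + x ^+ 2))).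
  have -> : EFin \o (fun x : R => C * (1 + x ^+ 2)) =
    (fun x : R => (C%:E * (1%:E + (x ^+ 2)%:E))%E) by apply/funext => x /=.
  apply: integrableZl => //; apply: integrableD => //.
  exact: finite_measure_integrable_cst.
apply: (le_integrable _ _ _ h1) => //=.
  exact/measurable_EFinP.
move=> x _; rewrite lee_fin (le_trans (Cg x))// ler_norm//.
Qed.

Lemma avgD g g' : quad_growth g -> quad_growth g' ->
  avg (fun x => g x + g' x) = avg g + avg g'.
Proof. by move=> hg hg'; apply: RintegralD => //; exact: quad_growth_integrable. Qed.

Lemma avgZ a g : quad_growth g -> avg (fun x => a * g x) = a * avg g.
Proof. by move=> hg; apply: RintegralZl => //; exact: quad_growth_integrable. Qed.

Lemma le_avg g g' : quad_growth g -> quad_growth g' ->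
  (forall x, g x <= g' x) -> avg g <= avg g'.
Proof.
by move=> hg hg' gg'; apply: le_Rintegral => //; exact: quad_growth_integrable.
Qed.

Lemma avg_ge0 g : (forall x, 0 <= g x) -> 0 <= avg g.
Proof. by move=> g0; apply: Rintegral_ge0. Qed.

Lemma avg_cst c : avg (fun=> c) = c.
Proof. by rewrite /avg Rintegral_cst//= probability_setT mulr1. Qed.

(** Tonelli's theorem gives measurability of partial integrals of nonnegative functions, hence the
    split into positive and negative parts. *)
Lemma measurable_avg_shift (g : R -> R) : measurable_fun setT g ->
  measurable_fun setT (fun x : R => avg (fun z => g (x + z))).
Proof.
move=> mg; rewrite /avg /Rintegral; apply: measurableT_comp => //=.
have mG : measurable_fun setT (fun xz : R * R => (g (xz.1 + xz.2))%:E).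
  apply/measurable_EFinP; apply: measurableT_comp => //.
  exact: measurable_funD.
have -> : (fun x => \int[mu]_z (g (x + z))%:E)%E =
  (fun x => \int[mu]_z ((fun xz : R * R => (g (xz.1 + xz.2))%:E)^\+ (x, z)) -
    \int[mu]_z ((fun xz : R * R => (g (xz.1 + xz.2))%:E)^\- (x, z)))%E.
  apply/funext => x; rewrite [LHS]integralE; congr (_ - _)%E;
    by apply: eq_integral => z _; rewrite ?funeposE ?funenegE.
apply: emeasurable_funB.
- have := @measurable_fun_fubini_tonelli_F _ _ R R R mu
    ((fun xz : R * R => (g (xz.1 + xz.2)%R)%:E)^\+)%E.
  rewrite /fubini_F; apply.
  + exact: measurable_funepos.
  + by move=> ?; exact: funepos_ge0.
- have := @measurable_fun_fubini_tonelli_F _ _ R R R mu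
    ((fun xz : R * R => (g (xz.1 + xz.2)%R)%:E)^\-)%E.
  rewrite /fubini_F; apply.
  + exact: measurable_funeneg.
  + by move=> ?; exact: funeneg_ge0.
Qed.
End Averages.

(** * Expectations along a walk that stays in increasing sets *)

Section Stay.
Context (R : realType) (mu : probability R R).
Context (sq_int : mu.-integrable setT (EFin \o (fun z : R => z ^+ 2))).
Local Notation avg := (avg mu).

Lemma quad_growth_cst (c : R) : quad_growth (fun=> c).
Proof. exact/lin_quad/lin_growth_cst. Qed.

Lemma lin_growth_norm (g : R -> R) : lin_growth g ->
  lin_growth (fun x => `|g x|).
Proof.
move=> [mg [C Cg]]; split; last by exists C => x; rewrite normr_id.
exact: measurableT_comp.
Qed.

Lemma le_norm_avg (g k : R -> R) : quad_growth g -> quad_growth k ->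
  (forall z, `|g z| <= k z) -> `|avg g| <= avg k.
Proof.
move=> hg hk gk; rewrite ler_norml -mulN1r -avgZ//.
apply/andP; split; apply: le_avg => //.
- exact: quad_growthZ.
- by move=> z; have := gk z; rewrite ler_norml mulN1r => /andP[].
- by move=> z; have := gk z; rewrite ler_norml => /andP[].
Qed.

Lemma quad_growth_shift (c : R) (g : R -> R) : quad_growth g ->
  quad_growth (fun x => g (x + c)).
Proof.
move=> [mg [C Cg]]; split.
  by apply: measurableT_comp => //; exact: measurable_funD.
exists (2 * C * (1 + c ^+ 2)) => x.
have C0 : 0 <= C.
  by have := Cg 0; rewrite expr0n/= addr0 mulr1; exact: le_trans.
apply: (le_trans (Cg _)).
have -> : 2 * C * (1 + c ^+ 2) * (1 + x ^+ 2) =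
          C * (2 * ((1 + c ^+ 2) * (1 + x ^+ 2))) by ring.
rewrite ler_wpM2l//.
have := sqr_ge0 (x - c); have := mulr_ge0 (sqr_ge0 x) (sqr_ge0 c); nra.
Qed.

Lemma quad_growth_shiftl (c : R) (g : R -> R) : quad_growth g ->
  quad_growth (fun x => g (c + x)).
Proof.
by move=> /(quad_growth_shift c); under eq_fun do rewrite addrC.
Qed.

Lemma lin_growth_shiftl (c : R) (g : R -> R) : lin_growth g ->
  lin_growth (fun x => g (c + x)).
Proof.
by move=> /(lin_growth_shift c); under eq_fun do rewrite addrC.
Qed.

Lemma quad_growth_avg (g : R -> R) : quad_growth g ->
  quad_growth (fun x => avg (fun z => g (x + z))).
Proof.
move=> gg; have [mg [C Cg]] := gg; split; first exact: measurable_avg_shift.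
have C0 : 0 <= C.
  by have := Cg 0; rewrite expr0n/= addr0 mulr1; exact: le_trans.
have qs := @quad_growth_sq R.
have m2 : 0 <= avg (fun z => z ^+ 2) by apply: avg_ge0 => z; exact: sqr_ge0.
exists (2 * C * (1 + avg (fun z => z ^+ 2))) => x.
apply: (@le_trans _ _ (avg (fun z => C * (1 + 2 * x ^+ 2) + 2 * C * z ^+ 2))).
  apply: le_norm_avg => [||z].
  - exact: quad_growth_shiftl.
  - by apply: quad_growthD; [exact: quad_growth_cst|exact: quad_growthZ].
  - apply: (le_trans (Cg _)).
    have -> : C * (1 + 2 * x ^+ 2) + 2 * C * z ^+ 2 =
              C * (1 + 2 * x ^+ 2 + 2 * z ^+ 2) by ring.
    by rewrite ler_wpM2l//; have := sqr_ge0 (x - z); nra.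
rewrite avgD ?avg_cst ?avgZ//; [|exact: quad_growth_cst|exact: quad_growthZ].
have := mulr_ge0 C0 m2; have := mulr_ge0 (mulr_ge0 C0 m2) (sqr_ge0 x).
have := mulr_ge0 C0 (sqr_ge0 x); lra.
Qed.

Lemma lin_growth_avg (g : R -> R) : lin_growth g ->
  lin_growth (fun x => avg (fun z => g (x + z))).
Proof.
move=> gg; have [mg [C Cg]] := gg; split; first exact: measurable_avg_shift.
have C0 : 0 <= C by have := Cg 0; rewrite normr0 addr0 mulr1; exact: le_trans.
have ln : lin_growth (fun z : R => `|z|).
  exact: lin_growth_norm (@lin_growth_id R).
have m2 : 0 <= avg (fun z => `|z|) by apply: avg_ge0.
exists (C * (1 + avg (fun z => `|z|))) => x.
apply: (@le_trans _ _ (avg (fun z => C * (1 + `|x|) + C * `|z|))).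
  apply: le_norm_avg => [||z].
  - exact/quad_growth_shiftl/lin_quad.
  - apply: quad_growthD; [exact: quad_growth_cst|].
    exact/quad_growthZ/lin_quad.
  - apply: (le_trans (Cg _)); rewrite -mulrDr ler_wpM2l//.
    by have := ler_normD x z; lra.
rewrite avgD ?avg_cst ?avgZ//;
  [|exact: lin_quad|exact: quad_growth_cst|exact/quad_growthZ/lin_quad].
have := mulr_ge0 (mulr_ge0 C0 m2) (normr_ge0 x); lra.
Qed.

(* Integrate (u z - u y) (v z - v y) >= 0 over z and then over y. *)
Lemma avg_association (u v : R -> R) : lin_growth u -> lin_growth v ->
  {homo u : x y / x <= y} -> {homo v : x y / x <= y} ->
  avg u * avg v <= avg (fun z => u z * v z).
Proof.
move=> lu lv ndu ndv; have quv := lin_growthM lu lv.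
have [qu qv] := (lin_quad lu, lin_quad lv).
have H y : u y * avg v + v y * avg u <= avg (fun z => u z * v z) + u y * v y.
  rewrite -[u y * v y](avg_cst mu) -avgZ// -avgZ// -!avgD//;
    do ?[exact: quad_growth_cst|exact: quad_growthZ].
  apply: le_avg => // [||z].
  - by apply: quad_growthD; exact: quad_growthZ.
  - by apply: quad_growthD => //; exact: quad_growth_cst.
  - have [/[dup] /ndu + /ndv|/ltW/[dup] /ndu + /ndv] := lerP y z; nra.
have : avg (fun y => u y * avg v + v y * avg u) <=
       avg (fun y => avg (fun z => u z * v z) + u y * v y).
  apply: le_avg => //.
  - under eq_fun do rewrite mulrC [v _ * _]mulrC.
    by apply: quad_growthD; exact: quad_growthZ.
  - by apply: quad_growthD => //; exact: quad_growth_cst.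
under eq_fun do rewrite mulrC [v _ * _]mulrC.
rewrite !avgD// ?avg_cst ?avgZ//;
  do ?[exact: quad_growth_cst|exact: quad_growthZ].
lra.
Qed.

Definition cut (p : R -> bool) (g : R -> R) (x : R) : R := (p x)%:R * g x.

Definition step (p : R -> bool) (g : R -> R) (x : R) : R :=
  avg (fun z => cut p g (x + z)).

(* With [S_n] the walk of step law [mu] started at [0], [stay p n g] is the
   expectation of [g S_n] on the event that [p k S_k] holds for all [k <= n]. *)
Fixpoint stay (p : nat -> R -> bool) (n : nat) (g : R -> R) : R :=
  if n is m.+1 then stay p m (step (p m.+1) g) else cut (p 0%N) g 0.

(** Up-sets of the line: their indicators are nondecreasing, which yields measurability and makes
    survival an increasing event for Harris' inequality. *)
Definition upward (p : R -> bool) := forall x y, x <= y -> p x -> p y.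

Lemma lin_growth_indic (p : R -> bool) : upward p ->
  lin_growth (fun x => (p x)%:R).
Proof.
move=> up; split; last first.
  exists 1 => x; rewrite mul1r normr_nat.
  by case: (p x); [rewrite lerDl|rewrite addr_ge0].
apply: nondecreasing_meas => x y /up; case: (p x) => [->//|_].
by case: (p y); rewrite ?ler01.
Qed.

Lemma quad_growth_cut p g : upward p -> quad_growth g -> quad_growth (cut p g).
Proof.
move=> up [mg [C Cg]]; split.
  by apply: measurable_funM => //; have [] := lin_growth_indic up.
exists C => x; rewrite normrM normr_nat; apply: le_trans (Cg x).
by case: (p x); rewrite ?mul1r ?mul0r.
Qed.

Lemma lin_growth_cut p g : upward p -> lin_growth g -> lin_growth (cut p g).
Proof.
move=> up [mg [C Cg]]; split.
  by apply: measurable_funM => //; have [] := lin_growth_indic up.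
exists C => x; rewrite normrM normr_nat; apply: le_trans (Cg x).
by case: (p x); rewrite ?mul1r ?mul0r.
Qed.

Lemma quad_growth_step p g : upward p -> quad_growth g -> quad_growth (step p g).
Proof. by move=> up qg; exact/quad_growth_avg/quad_growth_cut. Qed.

Lemma lin_growth_step p g : upward p -> lin_growth g -> lin_growth (step p g).
Proof. by move=> up qg; exact/lin_growth_avg/lin_growth_cut. Qed.

Lemma step_le p g g' x : upward p -> quad_growth g -> quad_growth g' ->
  (forall x, p x -> g x <= g' x) -> step p g x <= step p g' x.
Proof.
move=> up qg qg' gg'; apply: le_avg => //.
- exact/quad_growth_shiftl/quad_growth_cut.
- exact/quad_growth_shiftl/quad_growth_cut.
- move=> z; rewrite /cut; case: (p _) (gg' (x + z)); rewrite ?mul0r// !mul1r.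
  exact.
Qed.

(** The last [cut] erases the values outside [p n]. One-step inequalities thus have to be checked
    only at points where the walk is still alive. *)
Lemma stay_le p n g g' : (forall k, upward (p k)) ->
  quad_growth g -> quad_growth g' ->
  (forall x, p n x -> g x <= g' x) -> stay p n g <= stay p n g'.
Proof.
move=> up; elim: n g g' => [|n IHn] g g' qg qg' gg' /=.
  rewrite /cut; case: (p 0%N 0) (gg' 0); rewrite ?mul0r// !mul1r; exact.
apply: IHn => [||x _]; [exact: quad_growth_step..|exact: step_le].
Qed.

Lemma stayD p n g g' : (forall k, upward (p k)) ->
  quad_growth g -> quad_growth g' ->
  stay p n (fun x => g x + g' x) = stay p n g + stay p n g'.
Proof.
move=> up; elim: n g g' => [|n IHn] g g' qg qg' /=; first by rewrite /cut mulrDr.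
rewrite -IHn; [|exact: quad_growth_step..].
congr (stay p n _); apply/funext => x.
rewrite /step -avgD//; [|exact/quad_growth_shiftl/quad_growth_cut..].
by congr (avg _); apply/funext => z; rewrite /cut mulrDr.
Qed.

Lemma stayZ p n a g : (forall k, upward (p k)) -> quad_growth g ->
  stay p n (fun x => a * g x) = a * stay p n g.
Proof.
move=> up; elim: n g => [|n IHn] g qg /=; first by rewrite /cut mulrCA.
rewrite -IHn; last exact: quad_growth_step.
congr (stay p n _); apply/funext => x.
rewrite /step -avgZ//; last exact/quad_growth_shiftl/quad_growth_cut.
by congr (avg _); apply/funext => z; rewrite /cut mulrCA.
Qed.

Lemma stay_ge0 p n g : (forall k, upward (p k)) -> quad_growth g ->
  (forall x, p n x -> 0 <= g x) -> 0 <= stay p n g.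
Proof.
move=> up qg g0; have := @stayZ p n 0 g up qg; rewrite mul0r => <-.
by apply: stay_le => // [|x /g0]; [exact: quad_growthZ|rewrite mul0r].
Qed.

Lemma cut_ge0 p g : (forall x, 0 <= g x) -> forall x, 0 <= cut p g x.
Proof. by move=> g0 x; rewrite mulr_ge0. Qed.

Lemma cut_homo p g : upward p -> (forall x, 0 <= g x) ->
  {homo g : x y / x <= y} -> {homo cut p g : x y / x <= y}.
Proof.
move=> up g0 ndg x y xy; rewrite /cut; case: (p x) (up _ _ xy) => [->//|_].
  by rewrite !mul1r ndg.
by rewrite mul0r mulr_ge0.
Qed.

(** Induction on [n]: [step] keeps functions nonnegative and nondecreasing, and one step is handled
    by [avg_association]. The third family [q] stands for any event containing the intersection of
    the other two. *)
Lemma stay_harris p p' q n g g' :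
  (forall k, upward (p k)) -> (forall k, upward (p' k)) ->
  (forall k, upward (q k)) ->
  (forall k x, (k <= n)%N -> p k x -> p' k x -> q k x) ->
  lin_growth g -> lin_growth g' ->
  (forall x, 0 <= g x) -> (forall x, 0 <= g' x) ->
  {homo g : x y / x <= y} -> {homo g' : x y / x <= y} ->
  stay p n g * stay p' n g' <= stay q n (fun x => g x * g' x).
Proof.
move=> up up' uq; elim: n g g' => [|n IHn] g g' pq lg lg' g0 g'0 ndg ndg' /=.
  rewrite /cut mulrACA; have := pq 0%N 0 (leqnn _).
  case: (p 0%N 0); case: (p' 0%N 0); rewrite ?(mul0r, mul1r, mulr0) ?mulr_ge0//.
  by move=> ->//; rewrite mul1r.
have cl := lin_growth_cut (up n.+1) lg.
have cl' := lin_growth_cut (up' n.+1) lg'.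
have hc := cut_homo (up n.+1) g0 ndg.
have hc' := cut_homo (up' n.+1) g'0 ndg'.
apply: le_trans (IHn (step (p n.+1) g) (step (p' n.+1) g') _ _ _ _ _ _ _) _.
- by move=> k x kn; apply: pq; rewrite leqW.
- exact: lin_growth_step.
- exact: lin_growth_step.
- by move=> x; apply: avg_ge0 => z; exact: cut_ge0.
- by move=> x; apply: avg_ge0 => z; exact: cut_ge0.
- move=> x y xy; apply: le_avg => //; do ?[exact/quad_growth_shiftl/lin_quad].
  by move=> z; apply: hc; rewrite lerD2r.
- move=> x y xy; apply: le_avg => //; do ?[exact/quad_growth_shiftl/lin_quad].
  by move=> z; apply: hc'; rewrite lerD2r.
apply: stay_le => // [||x _].
- by apply: lin_growthM; exact: lin_growth_step.
- by apply: quad_growth_step => //; exact: lin_growthM.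
(* For fixed [x], both cut functions are nondecreasing in the last increment. *)
apply: le_trans (avg_association _ _ _ _) _.
- exact: lin_growth_shiftl.
- exact: lin_growth_shiftl.
- by move=> y z yz; apply: hc; rewrite lerD2l.
- by move=> y z yz; apply: hc'; rewrite lerD2l.
apply: le_avg => //.
- by apply: lin_growthM; exact: lin_growth_shiftl.
- by apply/quad_growth_shiftl/quad_growth_cut => //; exact: lin_growthM.
move=> z; rewrite /cut mulrACA; have := @pq n.+1 (x + z) (leqnn _).
case: (p n.+1 _); case: (p' n.+1 _); rewrite ?(mul0r, mul1r, mulr0) ?mulr_ge0//.
by move=> ->//; rewrite mul1r.
Qed.

Lemma stay_sub p p' n g : (forall k, upward (p k)) -> (forall k, upward (p' k)) ->
  (forall k x, (k <= n)%N -> p k x -> p' k x) -> quad_growth g ->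
  (forall x, 0 <= g x) -> stay p n g <= stay p' n g.
Proof.
move=> up up'; elim: n g => [|n IHn] g pp' qg g0 /=.
  rewrite /cut; have := pp' 0%N 0 (leqnn _).
  by case: (p 0%N 0) => [->//|_]; rewrite mul0r mulr_ge0.
apply: (@le_trans _ _ (stay p' n (step (p n.+1) g))).
  apply: IHn => [k x kn||x]; [by apply: pp'; rewrite leqW| |].
    exact: quad_growth_step.
  by apply: avg_ge0 => z; exact: cut_ge0.
apply: stay_le => // [||x _]; [exact: quad_growth_step..|].
apply: le_avg => //; do ?[exact/quad_growth_shiftl/quad_growth_cut].
move=> z; rewrite /cut; have := @pp' n.+1 (x + z) (leqnn _).
by case: (p n.+1 _) => [->//|_]; rewrite mul0r mulr_ge0.
Qed.

End Stay.

(** * The free walk *)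

Section FreeWalk.
Context (R : realType) (mu : probability R R).
Context (sq_int : mu.-integrable setT (EFin \o (fun z : R => z ^+ 2))).
Context (mean0 : avg mu id = 0).
Local Notation avg := (avg mu).
Local Notation stay := (stay mu).

Definition free (k : nat) (x : R) := true.

Definition pos (x : R) := Num.max x 0.

Definition var := avg (fun z => z ^+ 2).

(** The quantitative form of nondegeneracy. The truncation at 1 keeps the useful part of a step
    inside the quadratic zone of Huber's function. *)
Definition trunc_var := avg (fun z => Num.min (z ^+ 2) 1).

Lemma upward_free k : upward (free k). Proof. by []. Qed.
Local Hint Resolve upward_free : core.

Lemma cut_true g : cut (fun _ : R => true) g = g.
Proof. by apply/funext => x; rewrite /cut mul1r. Qed.

Lemma step_free k g : step mu (free k) g = fun x => avg (fun z => g (x + z)).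
Proof. by rewrite /step cut_true. Qed.

Lemma avg_shift_id x : avg (fun z => x + z) = x.
Proof.
rewrite avgD ?avg_cst//; last exact/lin_quad/lin_growth_id.
- by rewrite [X in _ + X]mean0 addr0.
- exact: quad_growth_cst.
Qed.

Lemma avg_shift_sq x : avg (fun z => (x + z) ^+ 2) = x ^+ 2 + var.
Proof.
have -> : (fun z => (x + z) ^+ 2) = (fun z => (x ^+ 2 + (2 * x) * z) + z ^+ 2).
  by apply/funext => z; ring.
have ql : quad_growth (@id R) by exact/lin_quad/lin_growth_id.
have qc := @quad_growth_cst R; have qs := @quad_growth_sq R.
rewrite avgD//; last by apply: quad_growthD => //; exact: quad_growthZ.
rewrite avgD//; last exact: quad_growthZ.
by rewrite avg_cst avgZ// [avg (fun x => x)]mean0 mulr0 addr0.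
Qed.

Lemma var_ge0 : 0 <= var.
Proof. by apply: avg_ge0 => z; exact: sqr_ge0. Qed.

Lemma stay_free_cst n c : stay free n (fun=> c) = c.
Proof.
elim: n => [|n IHn] /=; first by rewrite /cut mul1r.
by rewrite step_free avg_cst.
Qed.

Lemma stay_free_id n : stay free n id = 0.
Proof.
elim: n => [|n IHn] /=; first by rewrite /cut mul1r.
rewrite step_free -[RHS]IHn; congr (stay _ _ _).
by apply/funext => x; exact: avg_shift_id.
Qed.

Lemma stay_free_sq n : stay free n (fun x => x ^+ 2) = n%:R * var.
Proof.
elim: n => [|n IHn] /=; first by rewrite /cut mul1r expr0n/= mul0r.
rewrite step_free; under eq_fun do rewrite avg_shift_sq.
rewrite stayD//; [|exact: quad_growth_sq|exact: quad_growth_cst].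
by rewrite IHn stay_free_cst -addn1 natrD mulrDl mul1r.
Qed.

Lemma lin_growth_pos : lin_growth pos.
Proof.
split.
  by apply: nondecreasing_meas => x y xy; rewrite /pos ge_max !le_max xy lexx !orbT.
exists 1 => x; rewrite mul1r ger0_norm; last by rewrite le_max lexx orbT.
by rewrite ge_max addr_ge0// andbT; have := ler_norm x; lra.
Qed.

Lemma pos_homo : {homo pos : x y / x <= y}.
Proof. by move=> x y xy; rewrite /pos ge_max !le_max xy lexx !orbT. Qed.

Lemma pos_ge0 x : 0 <= pos x. Proof. by rewrite /pos le_max lexx orbT. Qed.

Lemma le_pos x : x <= pos x. Proof. by rewrite /pos le_max lexx. Qed.

Lemma pos_id x : 0 <= x -> pos x = x. Proof. by move=> x0; rewrite /pos max_l. Qed.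

(* Huber's function: the supremum of [t s - a t^2 / 2] over [|t| <= 1]. *)
Definition huber (a s : R) :=
  Num.min `|s| a * `|s| / a - Num.min `|s| a ^+ 2 / (2 * a).

Lemma huber_ge (a s t : R) : 0 < a -> `|t| <= 1 ->
  t * s - a * t ^+ 2 / 2 <= huber a s.
Proof.
move=> a0 t1; rewrite -(real_normK (num_real t)).
have : t * s <= `|t| * `|s| by rewrite -normrM ler_norm.
move: (normr_ge0 t) (normr_ge0 s) t1; rewrite /huber.
move: `|t| `|s| => u r u0 r0 u1 tsu.
have : u * r - a * u ^+ 2 / 2 <= Num.min r a * r / a - Num.min r a ^+ 2 / (2 * a).
  rewrite -subr_ge0; case: (lerP r a) => ra.
    have -> : r * r / a - r ^+ 2 / (2 * a) - (u * r - a * u ^+ 2 / 2) =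
      (r - a * u) ^+ 2 / (2 * a) by field; rewrite gt_eqF.
    by rewrite divr_ge0 ?sqr_ge0// ltW// mulr_gt0.
  have -> : a * r / a - a ^+ 2 / (2 * a) - (u * r - a * u ^+ 2 / 2) =
    (1 - u) * (r - a / 2 * (1 + u)) by field; rewrite gt_eqF.
  by rewrite mulr_ge0//; nra.
by lra.
Qed.

Lemma huber_le (a s : R) : 0 < a -> huber a s <= `|s|.
Proof.
move=> a0; rewrite /huber; move: (normr_ge0 s); move: `|s| => r r0.
rewrite -subr_ge0; case: (lerP r a) => ra.
  have -> : r - (r * r / a - r ^+ 2 / (2 * a)) = r * (2 * a - r) / (2 * a).
    by field; rewrite gt_eqF.
  by rewrite divr_ge0 ?mulr_ge0//; lra.
have -> : r - (a * r / a - a ^+ 2 / (2 * a)) = a / 2 by field; rewrite gt_eqF.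
by lra.
Qed.

Lemma lin_growth_huber a : 0 < a -> lin_growth (huber a).
Proof.
move=> a0; split.
  have mn : measurable_fun setT (fun s : R => `|s|) by exact: measurableT_comp.
  have mm : measurable_fun setT (fun s : R => Num.min `|s| a).
    exact: measurable_minr.
  apply: measurable_funB; apply: measurable_funM => //.
    exact: measurable_funM.
  exact: measurable_funX.
exists 1 => s; rewrite mul1r ger0_norm.
  by apply: (le_trans (huber_le _ a0)); rewrite lerDr.
have := @huber_ge a s 0 a0; rewrite normr0 ler01 => /(_ isT); lra.
Qed.

Lemma trunc_var_growth : quad_growth (fun z : R => Num.min (z ^+ 2) 1).
Proof.
split; first by apply: measurable_minr => //; exact: measurable_funX.
exists 1 => x; rewrite ger0_norm; last by rewrite le_min sqr_ge0/=.
by rewrite mul1r ge_min lerDl sqr_ge0 orbT.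
Qed.

Lemma huber_step (a s : R) : 2 <= a ->
  huber a s + trunc_var / (2 * a) * (1 - 4 * s ^+ 2 / a ^+ 2) <=
  avg (fun z => huber a (s + z)).
Proof.
move=> a2; have a0 : 0 < a by lra.
set K := (1 - 4 * s ^+ 2 / a ^+ 2) / (2 * a).
(* A supporting line of slope [t] plus a truncated quadratic term; [mean0] removes the linear part
   on averaging. *)
have [t Ht] : exists t : R, forall z : R,
    huber a s + (t * z + K * Num.min (z ^+ 2) 1) <= huber a (s + z).
  have K1 : K <= (2 * a)^-1.
    rewrite ler_pdivrMr ?mulr_gt0// mulVf ?gt_eqF ?mulr_gt0//.
    by rewrite gerBl divr_ge0 ?sqr_ge0// mulr_ge0 ?sqr_ge0//.
  have [sa|sa] := lerP (`|s|) (a / 2); last first.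
    have K0 : K <= 0.
      rewrite pmulr_lle0 ?invr_gt0 ?mulr_gt0// subr_le0 ler_pdivlMr ?exprn_gt0//.
      by rewrite mul1r -(real_normK (num_real s)); nra.
    have [t [t1 ts]] : exists t : R, `|t| <= 1 /\ huber a s = t * s - a * t ^+ 2 / 2.
      have [rs|rs] := lerP `|s| a.
        exists (s / a); rewrite normrM normfV (gtr0_norm a0) ler_pdivrMr// mul1r rs.
        split=> //; rewrite /huber min_l// -[`|s| * `|s|]expr2 real_normK ?num_real//.
        by field; rewrite gt_eqF.
      rewrite /huber min_r ?ltW//.
      move: rs; rewrite ltr_normr => /orP[rs|rs].
        have -> : `|s| = s by apply: ger0_norm; lra.
        exists 1; split; first by rewrite normr1.
        by field; rewrite gt_eqF.
      have -> : `|s| = - s by apply: ler0_norm; lra.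
      exists (-1); split; first by rewrite normrN1.
      by field; rewrite gt_eqF.
    exists t => z; have := @huber_ge a (s + z) t a0 t1; rewrite ts.
    have : K * Num.min (z ^+ 2) 1 <= 0 by rewrite mulr_le0_ge0// le_min sqr_ge0/=.
    lra.
  have -> : huber a s = s ^+ 2 / (2 * a).
    rewrite /huber min_l; last lra.
    rewrite -[`|s| * `|s|]expr2 real_normK ?num_real//.
    by field; rewrite gt_eqF.
  exists (s / a) => z.
  (* [e] is [z] truncated to [-1, 1]. Then [(s + e) / a] is an admissible slope, as [|s| <= a / 2]
     and [a >= 2]. *)
  have [e [e1 ez]] : exists e : R, `|e| <= 1 /\
      Num.min (z ^+ 2) 1 <= 2 * e * z - e ^+ 2.
    have [z1|z1] := lerP `|z| 1.
      by exists z; split=> //; rewrite ge_min; apply/orP; left; lra.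
    have m1 : Num.min (z ^+ 2) 1 <= 1 by rewrite ge_min lexx orbT.
    move: z1; rewrite ltr_normr => /orP[z1|z1].
      by exists 1; rewrite normr1; split=> //; lra.
    by exists (-1); rewrite normrN1; split=> //; lra.
  have se1 : `|(s + e) / a| <= 1.
    rewrite normrM normfV (gtr0_norm a0) ler_pdivrMr// mul1r.
    by have := ler_normD s e; lra.
  apply: le_trans (huber_ge _ a0 se1).
  have Km : K * Num.min (z ^+ 2) 1 <= (2 * a)^-1 * Num.min (z ^+ 2) 1.
    by apply: ler_wpM2r => //; rewrite le_min sqr_ge0/=.
  have em : (2 * a)^-1 * Num.min (z ^+ 2) 1 <= (2 * a)^-1 * (2 * e * z - e ^+ 2).
    by apply: ler_wpM2l => //; rewrite invr_ge0 mulr_ge0// ltW.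
  have -> : (s + e) / a * (s + z) - a * ((s + e) / a) ^+ 2 / 2 =
    s ^+ 2 / (2 * a) + (s / a * z + (2 * a)^-1 * (2 * e * z - e ^+ 2)).
    by field; rewrite gt_eqF.
  lra.
have -> : huber a s + trunc_var / (2 * a) * (1 - 4 * s ^+ 2 / a ^+ 2) =
    avg (fun z => huber a s + (t * z + K * Num.min (z ^+ 2) 1)).
  have ql : quad_growth (@id R) by exact/lin_quad/lin_growth_id.
  have qc := @quad_growth_cst R; have qt := trunc_var_growth.
  move: (huber a s) => hs.
  rewrite avgD//; last by apply: quad_growthD; exact: quad_growthZ.
  rewrite avgD//; [|exact: quad_growthZ..].
  rewrite avg_cst !avgZ// [avg (fun x => x)]mean0 mulr0 add0r.
  by rewrite -/trunc_var /K; field; rewrite gt_eqF.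
have qh : quad_growth (huber a) by exact/lin_quad/lin_growth_huber.
apply: le_avg => //; last exact: quad_growth_shiftl.
apply: quad_growthD; first exact: quad_growth_cst.
apply: quad_growthD; apply: quad_growthZ; last exact: trunc_var_growth.
exact/lin_quad/lin_growth_id.
Qed.

(** Sums [huber_step] over time; the negative term is controlled by E[S_k^2] = k [var] <= [N]
    [var]. *)
Lemma stay_free_huber a N n : 2 <= a -> (n <= N)%N ->
  n%:R * (trunc_var / (2 * a) * (1 - 4 * (N%:R * var) / a ^+ 2)) <=
  stay free n (huber a).
Proof.
move=> a2; have a0 : 0 < a by lra.
have qh : quad_growth (huber a) by exact/lin_quad/lin_growth_huber.
have qs := @quad_growth_sq R.
have tv0 : 0 <= trunc_var by apply: avg_ge0 => z; rewrite le_min sqr_ge0/=.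
elim: n => [|n IHn] nN.
  rewrite mul0r; apply: stay_ge0 => // x _.
  by have := @huber_ge a x 0 a0; rewrite normr0 ler01 => /(_ isT); lra.
rewrite /= step_free.
have qc : quad_growth (fun _ : R => trunc_var / (2 * a)) by exact: quad_growth_cst.
have qZ : quad_growth (fun x : R => (- (trunc_var / (2 * a) * 4 / a ^+ 2)) * x ^+ 2).
  exact: quad_growthZ.
have qg : quad_growth (fun x : R => trunc_var / (2 * a) +
    (- (trunc_var / (2 * a) * 4 / a ^+ 2)) * x ^+ 2) by exact: quad_growthD.
apply: (@le_trans _ _ (stay free n (fun x => huber a x + (trunc_var / (2 * a) +
    (- (trunc_var / (2 * a) * 4 / a ^+ 2)) * x ^+ 2)))); last first.
  apply: stay_le => // [||x _].
  - exact: quad_growthD.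
  - exact: quad_growth_avg.
  - by apply: le_trans (huber_step x a2); rewrite lerD2l le_eqVlt; apply/orP;
      left; apply/eqP; field; rewrite gt_eqF.
rewrite (stayD sq_int n upward_free qh qg) (stayD sq_int n upward_free qc qZ)
  stay_free_cst stayZ// stay_free_sq.
have := IHn (ltnW nN); rewrite -[n.+1]addn1 natrD.
have : n%:R * var <= N%:R * var :> R.
  by rewrite ler_wpM2r ?var_ge0// ler_nat ltnW.
have K0 : 0 <= trunc_var / (2 * a) * 4 / a ^+ 2.
  by rewrite divr_ge0 ?sqr_ge0// mulr_ge0// divr_ge0// mulr_ge0// ltW.
move=> /(ler_wpM2l K0).
have -> : trunc_var / (2 * a) * (1 - 4 * (N%:R * var) / a ^+ 2) =
  trunc_var / (2 * a) - trunc_var / (2 * a) * 4 / a ^+ 2 * (N%:R * var).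
  by field; rewrite gt_eqF.
lra.
Qed.

Context (nondeg : 0 < trunc_var).

Lemma var_gt0 : 0 < var.
Proof.
apply: (lt_le_trans nondeg); apply: le_avg => //.
- exact: trunc_var_growth.
- exact: quad_growth_sq.
- by move=> z; rewrite ge_min lexx.
Qed.

(** Mean zero gives E|S_n| = 2 E[S_n^+], and |S_n| dominates Huber's function, whose mean is of
    order sqrt n when its parameter is. *)
Lemma stay_free_pos : exists2 c, 0 < c &
  forall n, c * Num.sqrt n%:R <= stay free n pos.
Proof.
have v0 := var_gt0.
(* [L >= 2] makes [L * s] admissible as a parameter, and [L ^+ 2 >= 8 * var] makes the negative
   correction at most 1/2. *)
pose L := 2 + 2 * var; have L0 : 0 < L by rewrite /L; lra.
exists (trunc_var / (8 * L)); first by rewrite divr_gt0// mulr_gt0.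
move=> [|n].
  by rewrite sqrtr0 mulr0; apply: stay_ge0 => // [|x _];
    [exact/lin_quad/lin_growth_pos|exact: pos_ge0].
set s := Num.sqrt n.+1%:R.
have s1 : 1 <= s by rewrite -[leLHS]sqrtr1 ler_sqrt// ler1n.
have sE : s ^+ 2 = n.+1%:R by rewrite sqr_sqrtr.
have a2 : 2 <= L * s by rewrite /L; nra.
have a0 : 0 < L * s by rewrite mulr_gt0//; lra.
have qh : quad_growth (huber (L * s)) by exact/lin_quad/lin_growth_huber.
have qp : quad_growth pos by exact/lin_quad/lin_growth_pos.
have ql : quad_growth (@id R) by exact/lin_quad/lin_growth_id.
have H1 : stay free n.+1 (huber (L * s)) <= 2 * stay free n.+1 pos.
  have -> : 2 * stay free n.+1 pos = stay free n.+1 (fun x => 2 * pos x + (- 1) * x).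
    rewrite stayD//; [|exact: quad_growthZ..].
    by rewrite !stayZ// (stay_free_id n.+1) mulr0 addr0.
  apply: stay_le => // [|x _]; first by apply: quad_growthD; exact: quad_growthZ.
  apply: (le_trans (huber_le _ a0)); have := le_pos x; have := pos_ge0 x.
  by rewrite ler_norml; have [x0|/ltW x0] := lerP 0 x;
    [rewrite (pos_id x0)|]; lra.
have H2 := @stay_free_huber (L * s) n.+1 n.+1 a2 (leqnn _).
have H3 : 1 / 2 <= 1 - 4 * (n.+1%:R * var) / (L * s) ^+ 2.
  suff : 4 * (n.+1%:R * var) / (L * s) ^+ 2 <= 1 / 2 by lra.
  rewrite ler_pdivrMr ?exprn_gt0// exprMn sE.
  have : 0 < n.+1%:R :> R by rewrite ltr0n.
  rewrite /L; nra.
have H4 : n.+1%:R * (trunc_var / (2 * (L * s)) * (1 / 2)) = 2 * (trunc_var / (8 * L) * s).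
  by rewrite -sE; field; rewrite !gt_eqF//; lra.
have : n.+1%:R * (trunc_var / (2 * (L * s)) * (1 / 2)) <=
  n.+1%:R * (trunc_var / (2 * (L * s)) * (1 - 4 * (n.+1%:R * var) / (L * s) ^+ 2)).
  rewrite ler_wpM2l// ler_wpM2l// divr_ge0 ?ltW// mulr_gt0//.
lra.
Qed.

Lemma upward_ge (y : R) : upward (fun x => y <= x).
Proof. by move=> a b ab ya; exact: le_trans ab. Qed.

(** Paley-Zygmund argument: a mean of S_n^+ of at least c sqrt n cannot come from values below (c /
    4) sqrt n, nor, as E[S_n^2] = n [var], from rare large values alone. *)
Lemma stay_free_tail : exists a c : R, [/\ 0 < a, 0 < c &
  forall n (y : R), (0 < n)%N -> y <= a * Num.sqrt n%:R ->
    c <= stay free n (fun x : R => (y <= x)%R%:R)].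
Proof.
have v0 := var_gt0.
have [c c0 Hc] := stay_free_pos.
exists (c / 4), (c ^+ 2 / (2 * var)); split.
- by rewrite divr_gt0.
- by rewrite divr_gt0 ?exprn_gt0// mulr_gt0.
move=> n y n0 yn; have {Hc} := Hc n.
set s := Num.sqrt n%:R in yn *.
have s0 : 0 < s by rewrite sqrtr_gt0 ltr0n.
have sE : s ^+ 2 = n%:R by rewrite sqr_sqrtr.
have qi : quad_growth (fun x : R => (y <= x)%R%:R).
  exact/lin_quad/lin_growth_indic/upward_ge.
have qc := @quad_growth_cst R; have qs := @quad_growth_sq R.
have qp : quad_growth pos by exact/lin_quad/lin_growth_pos.
(* With this [l] the quadratic term has mean [c / 4 * s], so half of [c * s] is left for the
   indicator. *)
pose l := 2 * var * s / c; have l0 : 0 < l by rewrite divr_gt0// !mulr_gt0.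
have : stay free n pos <= stay free n (fun x => (c / 4 * s + (2 * l)^-1 * x ^+ 2)
    + (l / 2) * (y <= x)%R%:R).
  apply: stay_le => // [|x _].
    by do ?apply: quad_growthD => //; exact: quad_growthZ.
  have cs : 0 < c / 4 * s by rewrite mulr_gt0// divr_gt0.
  have xl : 0 <= (2 * l)^-1 * x ^+ 2.
    by rewrite mulr_ge0 ?sqr_ge0// invr_ge0 mulr_ge0// ltW.
  have [x0|/ltW x0] := lerP 0 x; last first.
    by rewrite /pos max_r//; case: (y <= x) => /=; rewrite ?mulr0 ?mulr1; lra.
  rewrite pos_id//; case: (lerP y x) => yx /=; last by rewrite mulr0; lra.
  have -> : c / 4 * s + (2 * l)^-1 * x ^+ 2 + l / 2 * 1 =
     c / 4 * s + x + (x - l) ^+ 2 / (2 * l) by field; rewrite gt_eqF.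
  have : 0 <= (x - l) ^+ 2 / (2 * l) by rewrite divr_ge0 ?sqr_ge0// mulr_ge0// ltW.
  by lra.
rewrite stayD//; [|by apply: quad_growthD => //; exact: quad_growthZ|exact: quad_growthZ].
rewrite stayD//; last exact: quad_growthZ.
rewrite stay_free_cst !stayZ// stay_free_sq -sE.
have -> : (2 * l)^-1 * (s ^+ 2 * var) = c / 4 * s.
  by rewrite /l; field; rewrite !gt_eqF.
move: (stay free n (fun x => (y <= x)%R%:R)) => p H1 H2.
have : c / 2 * s <= (2 * var * s / c) / 2 * p by rewrite -/l; lra.
rewrite ler_pdivrMr ?mulr_gt0//.
have -> : 2 * var * s / c / 2 * p = s * (var * p / c) by field; rewrite gt_eqF.
rewrite mulrC ler_pM2l// ler_pdivlMr//; lra.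
Qed.

End FreeWalk.

(** * A superharmonic function for the killed walk *)

Section Superharmonic.
Context (R : realType) (mu : probability R R).
Context (sq_int : mu.-integrable setT (EFin \o (fun z : R => z ^+ 2))).
Context (mean0 : avg mu id = 0) (nondeg : 0 < trunc_var mu).
Local Notation avg := (avg mu).

(* The depth of [x + z] below [0]. *)
Definition overshoot (x z : R) := pos (- z - x).

(** Each third power would need a third moment, but for [x >= 0] the difference is at most
    [x * z ^+ 2 / 2]. Its derivatives in [x] are [overshoot x z ^+ 2 / 2] and [- overshoot x z]. *)
Definition cubic (x z : R) := (overshoot 0 z ^+ 3 - overshoot x z ^+ 3) / 6.

Lemma pos_subr (u v : R) : 0 <= v -> pos u - v <= pos (u - v) <= pos u.
Proof.
by move=> v0; rewrite /pos; case: (lerP u 0); case: (lerP (u - v) 0) => *;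
  apply/andP; split; lra.
Qed.

Lemma overshoot_add x y z : 0 <= y ->
  overshoot x z - y <= overshoot (x + y) z <= overshoot x z.
Proof. by move=> y0; rewrite /overshoot opprD addrA; exact: pos_subr. Qed.

Lemma cubic0 z : cubic 0 z = 0.
Proof. by rewrite /cubic subrr mul0r. Qed.

Lemma cubic_add x y z : 0 <= y ->
  cubic x z <= cubic (x + y) z <= cubic x z + y * (overshoot x z ^+ 2 / 2).
Proof.
move=> y0; have := overshoot_add x z y0; rewrite /cubic.
move: (overshoot 0 z) (pos_ge0 (- z - x)) (pos_ge0 (- z - (x + y))) => c.
rewrite -/(overshoot x z) -/(overshoot (x + y) z).
move: (overshoot x z) (overshoot (x + y) z) => a b a0 b0 /andP[ab ba].
have E : a ^+ 3 - b ^+ 3 = (a - b) * (a ^+ 2 + a * b + b ^+ 2) by ring.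
have H0 : 0 <= a ^+ 2 + a * b + b ^+ 2 by rewrite !addr_ge0 ?sqr_ge0// mulr_ge0.
have H1 : a ^+ 2 + a * b + b ^+ 2 <= 3 * a ^+ 2 by nra.
have H2 : 0 <= (a - b) * (a ^+ 2 + a * b + b ^+ 2) by rewrite mulr_ge0 ?subr_ge0.
have H3 : (a - b) * (a ^+ 2 + a * b + b ^+ 2) <= y * (3 * a ^+ 2).
  by apply: ler_pM => //; lra.
by apply/andP; split; lra.
Qed.

(** The second-order Taylor polynomial is an upper bound to the left of [x], since the second
    derivative [- overshoot] only gets more negative there. *)
Lemma cubic_sub x v z : 0 <= v ->
  cubic (x - v) z <= cubic x z - v * (overshoot x z ^+ 2 / 2) - v ^+ 2 / 2 * overshoot x z.
Proof.
move=> v0; rewrite /cubic /overshoot opprB addrA.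
move: (pos (- z - 0)) => c; rewrite addrAC.
move: (- z - x) => u; rewrite {2 3 4}/pos; case: (lerP u 0) => u0; last first.
  rewrite pos_id; last lra.
  rewrite -subr_ge0.
  have -> : (c ^+ 3 - u ^+ 3) / 6 - v * (u ^+ 2 / 2) - v ^+ 2 / 2 * u -
     (c ^+ 3 - (u + v) ^+ 3) / 6 = v ^+ 3 / 6 by field.
  by rewrite divr_ge0// exprn_ge0.
have : 0 <= pos (u + v) ^+ 3 by rewrite exprn_ge0// pos_ge0.
by rewrite !expr0n/=; lra.
Qed.

Lemma overshoot_le_norm x z : 0 <= x -> 0 <= overshoot x z <= `|z|.
Proof.
move=> x0; rewrite /overshoot pos_ge0/= ge_max normr_ge0 andbT.
by have := ler_norm (- z); rewrite normrN; lra.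
Qed.

Lemma overshoot_sq_le x z : 0 <= x -> overshoot x z ^+ 2 <= z ^+ 2.
Proof.
move=> x0; rewrite -(real_normK (num_real z)).
by have /andP[? ?] := overshoot_le_norm z x0; rewrite lerXn2r ?nnegrE.
Qed.

Lemma measurable_overshoot x : measurable_fun setT (overshoot x).
Proof.
apply: measurable_maxr => //; apply: measurable_funB => //.
Qed.

Lemma lin_growth_overshoot x : 0 <= x -> lin_growth (overshoot x).
Proof.
move=> x0; split; first exact: measurable_overshoot.
exists 1 => z; have /andP[z0 zz] := overshoot_le_norm z x0.
by rewrite ger0_norm// mul1r (le_trans zz)// lerDr.
Qed.

Lemma quad_growth_overshoot_sq x : 0 <= x -> quad_growth (fun z => overshoot x z ^+ 2 / 2).
Proof.
move=> x0; split.
  apply: measurable_funM => //; apply: measurable_funX; exact: measurable_overshoot.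
exists 1 => z; rewrite ger0_norm ?divr_ge0 ?sqr_ge0//.
have := overshoot_sq_le z x0; have := sqr_ge0 z; have := sqr_ge0 (overshoot x z); lra.
Qed.

Lemma quad_growth_cubic x : 0 <= x -> quad_growth (cubic x).
Proof.
move=> x0; split.
  apply: measurable_funM => //; apply: measurable_funB; apply: measurable_funX;
    exact: measurable_overshoot.
exists x => z; have := cubic_add 0 z x0; rewrite add0r cubic0 add0r => /andP[c0 cx].
rewrite ger0_norm//; apply: (le_trans cx).
rewrite ler_wpM2l//; have := overshoot_sq_le z (lexx 0); have := sqr_ge0 z; lra.
Qed.

Definition deficit x := avg (overshoot x).

Definition half_deficit x := avg (fun z => overshoot x z ^+ 2 / 2).

(* On [0, +oo[ the second derivative of the corrector is [- deficit], and its
   first derivative is [half_deficit]. *)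
Definition corrector x := avg (cubic x).

Lemma corrector0 : corrector 0 = 0.
Proof.
rewrite /corrector (_ : cubic 0 = fun=> 0) ?avg_cst//.
by apply/funext => z; exact: cubic0.
Qed.

Lemma corrector_add x y : 0 <= x -> 0 <= y ->
  corrector x <= corrector (x + y) <= corrector x + y * half_deficit x.
Proof.
move=> x0 y0; have xy0 := addr_ge0 x0 y0.
have [qx qxy] := (quad_growth_cubic x0, quad_growth_cubic xy0).
have qu := quad_growth_overshoot_sq x0.
rewrite /corrector /half_deficit -avgZ// -avgD//; last exact: quad_growthZ.
apply/andP; split; apply: le_avg => //.
- by move=> z; have /andP[] := cubic_add x z y0.
- by apply: quad_growthD => //; exact: quad_growthZ.
- by move=> z; have /andP[] := cubic_add x z y0.
Qed.

Lemma corrector_sub x v : 0 <= v <= x ->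
  corrector (x - v) <= corrector x - v * half_deficit x - v ^+ 2 / 2 * deficit x.
Proof.
move=> /andP[v0 vx]; have x0 := le_trans v0 vx.
have xv0 : 0 <= x - v by rewrite subr_ge0.
have [qx qxy] := (quad_growth_cubic x0, quad_growth_cubic xv0).
have qu := quad_growth_overshoot_sq x0.
have ql := lin_quad (lin_growth_overshoot x0).
suff : corrector (x - v) + v * half_deficit x + v ^+ 2 / 2 * deficit x <=
    corrector x by lra.
have qZ1 := quad_growthZ v qu; have qZ2 := quad_growthZ (v ^+ 2 / 2) ql.
rewrite /corrector /half_deficit /deficit -!avgZ// -!avgD//; last exact: quad_growthD.
apply: le_avg => //.
- by apply: quad_growthD => //; exact: quad_growthD.
- by move=> z; have := cubic_sub x z v0; lra.
Qed.

Lemma deficit_ge0 x : 0 <= deficit x.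
Proof. by apply: avg_ge0 => z; exact: pos_ge0. Qed.

Lemma half_deficit_ge0 x : 0 <= half_deficit x.
Proof. by apply: avg_ge0 => z; rewrite divr_ge0 ?sqr_ge0. Qed.

Lemma deficit_nincr x y : 0 <= x -> x <= y -> deficit y <= deficit x.
Proof.
move=> x0 xy; apply: le_avg => //; try exact/lin_quad/lin_growth_overshoot/(le_trans x0).
move=> z; have := @overshoot_add x (y - x) z; rewrite subr_ge0 [x + _]addrC subrK.
by case/(_ xy)/andP.
Qed.

Lemma half_deficit_nincr x y : 0 <= x -> x <= y -> half_deficit y <= half_deficit x.
Proof.
move=> x0 xy; apply: le_avg => //; try exact/quad_growth_overshoot_sq/(le_trans x0).
move=> z; have := @overshoot_add x (y - x) z; rewrite subr_ge0 [x + _]addrC subrK.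
case/(_ xy)/andP => _ H; rewrite ler_wpM2r// lerXn2r ?nnegrE//; exact: pos_ge0.
Qed.

(** Dominated convergence with dominating function [z ^+ 2]. It makes the slope of the scaled
    corrector small far from the origin. *)
Lemma half_deficit_cvg0 e : 0 < e -> exists2 x, 0 <= x & half_deficit x <= e.
Proof.
move=> e0; pose F (n : nat) (z : R) := (overshoot n%:R z ^+ 2 / 2)%:E.
have mF n : measurable_fun setT (F n).
  by apply/measurable_EFinP; have [] := quad_growth_overshoot_sq (ler0n R n).
have cF : {ae mu, forall z, setT z -> F ^~ z @ \oo --> (cst 0%E z : \bar R)}.
  apply/aeW => z _; apply: cvg_near_cst; near=> n.
  rewrite /F /overshoot /pos max_r ?expr0n ?mul0r//= subr_le0.
  by near: n; exact: nbhs_infty_ger.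
have domF : {ae mu, forall z n, setT z -> (`|F n z| <= (z ^+ 2)%:E)%E}.
  apply/aeW => z n _; rewrite lee_fin ger0_norm ?divr_ge0 ?sqr_ge0//.
  have := overshoot_sq_le z (ler0n R n); have := sqr_ge0 (overshoot n%:R z).
  lra.
have [_ _] := @dominated_convergence _ _ R mu setT measurableT F (cst 0%E)
  (EFin \o (fun z => z ^+ 2)) mF (measurable_cst _) cF sq_int domF.
rewrite integral0 => /fine_cvgP[_].
move=> /cvgrPdist_le/(_ e e0) [N _ /(_ N)] /= /(_ (leqnn _)).
rewrite sub0r normrN => H; exists N%:R => //.
by apply: le_trans H; exact: ler_norm.
Unshelve. all: by end_near.
Qed.

(** [fall x] is the probability that a step from [x] ends below the origin, where the jump [J] is
    lost. [small_jumps x] measures the downward steps that stop before it, where concavity acts. *)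
Definition fall x := avg (fun z => 1 - (- x <= z)%R%:R).

Definition small_jumps x := avg (cut (fun z => - x <= z) (fun z => overshoot 0 z ^+ 2)).

Lemma quad_growth_fall x : quad_growth (fun z : R => 1 - (- x <= z)%R%:R).
Proof.
under eq_fun do rewrite -mulN1r.
apply: quad_growthD; first exact: quad_growth_cst.
exact/quad_growthZ/lin_quad/lin_growth_indic/upward_ge.
Qed.

Lemma quad_growth_neg_sq : quad_growth (fun z => overshoot 0 z ^+ 2).
Proof.
have := quad_growthZ 2 (quad_growth_overshoot_sq (lexx 0)).
by under eq_fun do rewrite mulrC divfK//.
Qed.

Lemma quad_growth_small_jumps x :
  quad_growth (cut (fun z => - x <= z) (fun z => overshoot 0 z ^+ 2)).
Proof. exact/quad_growth_cut/quad_growth_neg_sq/upward_ge. Qed.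

Lemma fall_ge0 x : 0 <= fall x.
Proof. by apply: avg_ge0 => z; case: (- x <= z); rewrite /= ?subrr ?subr0. Qed.

Lemma fall_nincr x y : x <= y -> fall y <= fall x.
Proof.
move=> xy; apply: le_avg => // [||z]; [exact: quad_growth_fall..|].
by rewrite lerD2l lerN2; have := @upward_ge R (- y) (- x); case: (lerP (- x) z);
  case: (lerP (- y) z) => //=; lra.
Qed.

(** [Num.min (z ^+ 2) 1] is at most |z| = 2 z^- + z, and [z] has mean zero. *)
Lemma deficit0_gt0 : 0 < deficit 0.
Proof.
have ql := lin_quad (lin_growth_overshoot (lexx 0)).
have qi : quad_growth (@id R) by exact/lin_quad/lin_growth_id.
suff : trunc_var mu <= 2 * deficit 0 by move: nondeg; lra.
have -> : 2 * deficit 0 = avg (fun z => 2 * overshoot 0 z + z).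
  by rewrite avgD ?avgZ//; [rewrite [avg (fun x => x)]mean0 addr0|exact: quad_growthZ].
apply: le_avg => //; first exact: trunc_var_growth.
  by apply: quad_growthD => //; exact: quad_growthZ.
move=> z; rewrite /overshoot subr0 /pos.
have : Num.min (z ^+ 2) 1 <= z ^+ 2 by rewrite ge_min lexx.
have : Num.min (z ^+ 2) 1 <= 1 by rewrite ge_min lexx orbT.
by case: (lerP (- z) 0) => *; nra.
Qed.

Lemma small_jumps_gt0 : exists2 x, 0 <= x & 0 < small_jumps x.
Proof.
have d0 := deficit0_gt0; have v0 := var_gt0 sq_int nondeg.
(* Steps below [- n] contribute at most [var mu / n], a quarter of [deficit 0]. The AM-GM term
   [e / 2] is another quarter, so the other steps must carry the remaining half. *)
pose n := 4 * var mu / deficit 0; have n0 : 0 < n by rewrite divr_gt0// mulr_gt0.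
exists n; first exact: ltW.
pose e := deficit 0 / 2; have e0 : 0 < e by rewrite divr_gt0.
have ql := lin_quad (lin_growth_overshoot (lexx 0)).
have qj := quad_growth_small_jumps n.
have qs := @quad_growth_sq R.
have qc : quad_growth (fun _ : R => e / 2) by exact: quad_growth_cst.
have : deficit 0 <= avg (fun z => e / 2 + ((2 * e)^-1 *
    cut (fun z => - n <= z) (fun z => overshoot 0 z ^+ 2) z + n^-1 * z ^+ 2)).
  apply: le_avg => //.
    by do ?apply: quad_growthD => //; exact: quad_growthZ.
  move=> z; rewrite /cut; have o0 : 0 <= overshoot 0 z by exact: pos_ge0.
  case: (lerP (- n) z) => nz /=.
    have : 0 <= n^-1 * z ^+ 2 by rewrite mulr_ge0 ?sqr_ge0// invr_ge0 ltW.
    have : 0 <= (overshoot 0 z - e) ^+ 2 / (2 * e).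
      by rewrite divr_ge0 ?sqr_ge0// mulr_ge0// ltW.
    have -> : (overshoot 0 z - e) ^+ 2 / (2 * e) = e / 2 + (2 * e)^-1 *
      overshoot 0 z ^+ 2 - overshoot 0 z by field; rewrite gt_eqF.
    by rewrite mul1r; lra.
  rewrite mul0r mulr0 add0r /overshoot subr0 pos_id; last lra.
  have -> : z ^+ 2 = - z * - z by ring.
  have : n^-1 * (n * - z) <= n^-1 * (- z * - z).
    by rewrite ler_wpM2l ?invr_ge0 1?ltW//; nra.
  by rewrite mulrA mulVf ?gt_eqF// mul1r; lra.
rewrite avgD//; last by apply: quad_growthD; exact: quad_growthZ.
rewrite avgD//; [|exact: quad_growthZ..].
rewrite avg_cst !avgZ// -/(var mu) -/(small_jumps n).
have -> : n^-1 * var mu = deficit 0 / 4 by rewrite /n; field; rewrite !gt_eqF.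
have ed : e / 2 = deficit 0 / 4 by rewrite /e; field.
rewrite ed => H; have : 0 < (2 * e)^-1 * small_jumps n by lra.
by rewrite pmulr_rgt0// invr_gt0 mulr_gt0.
Qed.

(** If [fall x0 > 0], both sides are compared at the ends of the interval by monotonicity. If
    [fall x0 = 0], almost no step goes below [- x0], so an overshoot has depth at most [x0]. *)
Lemma deficit_le_fall x0 : 0 <= x0 ->
  exists2 J, 0 <= J & forall x, 0 <= x <= x0 -> deficit x <= J * fall x.
Proof.
move=> x00; have := fall_ge0 x0; rewrite le_eqVlt => /predU1P[f0|f0]; last first.
  exists (deficit 0 / fall x0); first by rewrite divr_ge0 ?deficit_ge0 ?ltW.
  move=> x /andP[x1 x2]; apply: le_trans (deficit_nincr (lexx 0) x1) _.
  rewrite -mulrA ler_peMr ?deficit_ge0// mulrC ler_pdivlMr// mul1r.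
  exact: fall_nincr.
have ql := lin_quad (lin_growth_overshoot x00).
have qf := quad_growth_fall; have qs := @quad_growth_sq R.
(* AM-GM bounds the overshoot by an arbitrarily small multiple of the variance plus a large multiple
   of [fall x0], which is 0. *)
have dx0 : deficit x0 <= 0.
  have v0 := var_gt0 sq_int nondeg.
  apply/ler_addgt0Pr => e e0; rewrite add0r.
  pose t := 2 * e / var mu; have t0 : 0 < t by rewrite divr_gt0// mulr_gt0.
  have -> : e = t / 2 * var mu + (2 * t)^-1 * fall x0.
    by rewrite -f0 mulr0 addr0 /t; field; rewrite gt_eqF.
  rewrite -!avgZ// -avgD//; [|exact: quad_growthZ..].
  apply: le_avg => //; first by apply: quad_growthD; exact: quad_growthZ.
  move=> z; have tz : 0 <= t / 2 * z ^+ 2 by rewrite mulr_ge0 ?sqr_ge0// ltW// divr_gt0.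
  case: (lerP (- x0) z) => xz /=.
    by rewrite /overshoot /pos max_r; lra.
  have := overshoot_le_norm z x00; rewrite ler0_norm; last lra.
  have -> : t / 2 * z ^+ 2 + (2 * t)^-1 * (1 - 0) = - z + (t * z + 1) ^+ 2 / (2 * t).
    by field; rewrite gt_eqF.
  have : 0 <= (t * z + 1) ^+ 2 / (2 * t) by rewrite divr_ge0 ?sqr_ge0// mulr_ge0// ltW.
  lra.
exists x0 => // x /andP[x1 x2].
have : deficit x <= avg (fun z => x0 * (1 - (- x <= z)%R%:R) + overshoot x0 z).
  apply: le_avg => //; first exact/lin_quad/lin_growth_overshoot.
    by apply: quad_growthD => //; exact: quad_growthZ.
  move=> z; rewrite /overshoot /pos; case: (lerP (- x) z) => xz /=.
    by case: (lerP (- z - x) 0); case: (lerP (- z - x0) 0); lra.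
  by case: (lerP (- z - x) 0); case: (lerP (- z - x0) 0); lra.
rewrite avgD ?avgZ//; last exact: quad_growthZ.
by rewrite -/(deficit x0) -/(fall x); lra.
Qed.

(* On [0, +oo[ the function is [J + x + K * corrector x]. The jump [J] at the
   origin and the concavity of the corrector compensate for the expected
   overshoot [deficit x] below the origin: the concavity does so for large [x],
   and the jump for bounded [x]. *)
Lemma superharmonic_exists : exists (h : R -> R) (L : R),
  [/\ [/\ 0 <= L, lin_growth h & {homo h : x y / x <= y}],
      forall x, 0 <= h x, forall x, x <= h x,
      forall x y, 0 <= x -> 0 <= y -> h x + y <= h (x + y) <= h x + L * y
    & forall x, 0 <= x -> avg (fun z => h (x + z)) <= h x].
Proof.
have [x1 x10 q0] := small_jumps_gt0; set q := small_jumps x1 in q0.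
(* Chosen so that [K * r / 2 * q = 2 * r], which dominates [(1 + a) * r] as soon as [a <= 1]; this
   holds beyond [x2]. *)
pose K := 4 / q; have K0 : 0 < K by rewrite divr_gt0.
have [x2 x20 Kx2] := half_deficit_cvg0 (divr_gt0 ltr01 K0).
pose x0 := x1 + x2; have x00 : 0 <= x0 by rewrite addr_ge0.
have [J0 J00 HJ0] := deficit_le_fall x00.
pose L := 1 + K * half_deficit 0.
have Khd x : 0 <= x -> 0 <= K * half_deficit x <= K * half_deficit 0.
  move=> x_0; rewrite ler_pM2l// half_deficit_nincr// andbT.
  by rewrite mulr_ge0 ?half_deficit_ge0// ltW.
have L0 : 0 <= L by have /andP[] := Khd 0 (lexx 0); rewrite /L; lra.
(* The slope [1 + a] below never exceeds [L], so [J * fall x] pays for the overshoot on [0,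
   [x0]]. *)
pose J := L * J0; have J_ge0 : 0 <= J by rewrite mulr_ge0.
pose h (x : R) := if 0 <= x then J + x + K * corrector x else 0.
have c_ge0 x : 0 <= x -> 0 <= K * corrector x.
  move=> x_0; apply: mulr_ge0; first exact: ltW.
  by have := corrector_add (lexx 0) x_0; rewrite corrector0 add0r => /andP[].
have h_ge0 x : 0 <= h x.
  by rewrite /h; case: (lerP 0 x) => // x_0; have := c_ge0 _ x_0; lra.
have h_add x y : 0 <= x -> 0 <= y -> h x + y <= h (x + y) <= h x + L * y.
  move=> x_0 y_0; rewrite /h x_0 addr_ge0//.
  have /andP[] := corrector_add x_0 y_0.
  rewrite -(ler_pM2l K0) -(ler_pM2l K0 (corrector (x + y))) mulrDr mulrCA => A B.
  have /andP[_ /(ler_wpM2l y_0)] := Khd x x_0.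
  by move=> C; apply/andP; rewrite /L; split; lra.
have h_homo : {homo h : x y / x <= y}.
  move=> x y xy; have [x_0|x_0] := lerP 0 x; last first.
    by rewrite {1}/h ifF//; apply/negbTE; rewrite -ltNge.
  have := @h_add x (y - x) x_0; rewrite subr_ge0 [x + _]addrC subrK => /(_ xy).
  by case/andP; lra.
have lh : lin_growth h.
  split; first exact: nondecreasing_meas.
  exists (h 0 + L) => x; rewrite ger0_norm//.
  have h00 := h_ge0 0; have x1' := normr_ge0 x.
  have : h x <= h `|x| by apply: h_homo; exact: ler_norm.
  have /andP[_] := h_add 0 `|x| (lexx 0) (normr_ge0 x); rewrite add0r.
  have := mulr_ge0 h00 x1'; lra.
exists h, L; split => //.
- move=> x; have [x_0|x_0] := lerP 0 x; last by have := h_ge0 x; lra.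
  by rewrite /h x_0; have := c_ge0 _ x_0; lra.
move=> x x_0.
set a := K * half_deficit x; set r := deficit x.
have r0 : 0 <= r by exact: deficit_ge0.
have /andP[a0 aL] : 0 <= a <= K * half_deficit 0 by exact: Khd.
(* Left: the mean gain from cutting off the tangent of slope [1 + a] below the origin. Right: the
   loss of the jump and the loss by concavity. *)
have key : (1 + a) * r <= J * fall x + K * r / 2 * small_jumps x.
  have Kr0 : 0 <= K * r / 2 by rewrite divr_ge0// mulr_ge0// ltW.
  have sj0 : 0 <= small_jumps x.
    by apply: avg_ge0 => z; apply: cut_ge0 => w; exact: sqr_ge0.
  have [xx0|/ltW xx0] := lerP x x0.
    have := HJ0 x; rewrite x_0 xx0 => /(_ isT) /(ler_wpM2l L0).
    rewrite mulrA -/J -/r; have : 0 <= K * r / 2 * small_jumps x by rewrite mulr_ge0.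
    have : (1 + a) * r <= L * r by rewrite ler_wpM2r// /L; lra.
    lra.
  have a1 : a <= 1.
    rewrite /a mulrC -ler_pdivlMr//; apply: le_trans Kx2; apply: half_deficit_nincr => //.
    by move: xx0; rewrite /x0; lra.
  have : q <= small_jumps x.
    apply: le_avg => //; [exact: quad_growth_small_jumps..|].
    move=> z; rewrite /cut; have := sqr_ge0 (overshoot 0 z).
    case: (lerP (- x1) z) => z1 /=; case: (lerP (- x) z) => z2 /=;
      rewrite ?mul0r ?mul1r//; by move: xx0; rewrite /x0; lra.
  move=> /(ler_wpM2l Kr0).
  have -> : K * r / 2 * q = 2 * r by rewrite /K; field; rewrite gt_eqF.
  have : 0 <= J * fall x by rewrite mulr_ge0 ?fall_ge0.
  have : (1 + a) * r <= 2 * r by rewrite ler_wpM2r//; lra.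
  lra.
(* Upward steps use the tangent, downward steps inside [0, +oo[ the second-order bound. For steps
   below the origin, where [h] vanishes, [corrector x >= x * half_deficit x] suffices. *)
have pw z : h (x + z) <= h x + ((1 + a) * z + ((1 + a) * overshoot x z +
    ((- J) * (1 - (- x <= z)%R%:R) + (- (K * r / 2)) *
      cut (fun z => - x <= z) (fun z => overshoot 0 z ^+ 2) z))).
  rewrite /cut; have [z0|z0] := lerP 0 z.
    have -> /= : - x <= z by lra.
    have -> : overshoot x z = 0 by rewrite /overshoot /pos max_r//; lra.
    have -> : overshoot 0 z = 0 by rewrite /overshoot /pos max_r//; lra.
    have /andP[_] := corrector_add x_0 z0; rewrite -(ler_pM2l K0) mulrDr mulrCA.
    rewrite -/a /h x_0 addr_ge0// !expr0n/=; lra.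
  case: (lerP (- x) z) => xz /=.
    have -> : overshoot x z = 0 by rewrite /overshoot /pos max_r//; lra.
    have -> : overshoot 0 z = - z by rewrite /overshoot subr0 pos_id//; lra.
    have := @corrector_sub x (- z); rewrite opprK => /(_ _).
    case: (0 <= - z <= x) / andP => [_ /(_ isT)|[]]; last by split; lra.
    rewrite -(ler_pM2l K0) /h x_0 ifT; last lra.
    rewrite -/r; have -> : a = K * half_deficit x by [].
    nra.
  rewrite /h ifF; last by apply/negbTE; rewrite -ltNge; lra.
  rewrite x_0 mul0r mulr0 addr0 subr0 mulr1.
  have -> : overshoot x z = - z - x by rewrite /overshoot pos_id//; lra.
  have := @corrector_sub x x; rewrite x_0 lexx subrr corrector0 => /(_ isT).
  have : 0 <= x ^+ 2 / 2 * r by rewrite mulr_ge0// divr_ge0 ?sqr_ge0.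
  rewrite -/r => A B; have : 0 <= K * (corrector x - x * half_deficit x).
    by apply: mulr_ge0; [exact: ltW|lra].
  have -> : a = K * half_deficit x by [].
  lra.
have qi : quad_growth (@id R) by exact/lin_quad/lin_growth_id.
have qo := lin_quad (lin_growth_overshoot x_0).
have qf := quad_growth_fall x; have qj := quad_growth_small_jumps x.
have qc : quad_growth (fun _ : R => h x) by exact: quad_growth_cst.
have qZ1 := quad_growthZ (- (K * r / 2)) qj; have qZ2 := quad_growthZ (- J) qf.
have qZ3 := quad_growthZ (1 + a) qo; have qZ4 := quad_growthZ (1 + a) qi.
have qD1 := quad_growthD qZ2 qZ1; have qD2 := quad_growthD qZ3 qD1.
have qD3 := quad_growthD qZ4 qD2.
apply: (@le_trans _ _ (avg (fun z => h x + ((1 + a) * z + ((1 + a) * overshoot x z +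
    ((- J) * (1 - (- x <= z)%R%:R) + (- (K * r / 2)) *
      cut (fun z => - x <= z) (fun z => overshoot 0 z ^+ 2) z)))))).
  apply: le_avg => //; last exact: quad_growthD.
  exact/quad_growth_shiftl/lin_quad.
rewrite (avgD sq_int qc qD3) (avgD sq_int qZ4 qD2) (avgD sq_int qZ3 qD1).
rewrite (avgD sq_int qZ2 qZ1) avg_cst !avgZ// [avg (fun x => x)]mean0.
rewrite -/(deficit x) -/(fall x) -/(small_jumps x) -/r; lra.
Qed.

End Superharmonic.

(** * Abel summation *)

Section AbelSummation.
Context (R : realType).

Definition sqrtn (n : nat) : R := Num.sqrt n%:R.

Lemma sqrtn_gt0 n : (0 < n)%N -> 0 < sqrtn n.
Proof. by move=> n0; rewrite sqrtr_gt0 ltr0n. Qed.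

Lemma sqrtn_ge0 n : 0 <= sqrtn n. Proof. exact: sqrtr_ge0. Qed.

Lemma sqrtn_sq n : sqrtn n ^+ 2 = n%:R.
Proof. by rewrite sqr_sqrtr. Qed.

Lemma sqrtn_le m n : (m <= n)%N -> sqrtn m <= sqrtn n.
Proof. by move=> mn; rewrite ler_sqrt// ler_nat. Qed.

Lemma sqrtn_double n : sqrtn n.*2 <= 2 * sqrtn n.
Proof.
rewrite -ler_sqr ?nnegrE ?mulr_ge0 ?sqrtn_ge0//.
by rewrite exprMn !sqrtn_sq -mul2n natrM; have := ler0n R n; lra.
Qed.

Lemma sqrtn_succ n : (0 < n)%N -> sqrtn n.+1 <= 2 * sqrtn n.
Proof.
move=> n0; apply: le_trans (sqrtn_double n); apply: sqrtn_le.
by rewrite -addnn -addn1 leq_add2l.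
Qed.

(** Discrete derivative of n^(-1/2), from (sqrt (n+1) - sqrt n)(sqrt (n+1) + sqrt n) = 1. Each bound
    is taken at the index that its direction of Abel summation produces. *)
Lemma sqrtn_diff n : (0 < n)%N ->
  (sqrtn n ^+ 3)^-1 / 6 <= (sqrtn n)^-1 - (sqrtn n.+1)^-1 <=
  2 * (sqrtn n.+1 ^+ 3)^-1.
Proof.
move=> n0; have s0 := sqrtn_gt0 n0; have s'0 := sqrtn_gt0 (ltn0Sn n).
have ss' := sqrtn_le (leqnSn n); have s's := sqrtn_succ n0.
have : sqrtn n.+1 ^+ 2 = sqrtn n ^+ 2 + 1 by rewrite !sqrtn_sq -natr1.
move: (sqrtn n) (sqrtn n.+1) s0 s'0 ss' s's => s s' s0 s'0 ss' s's E.
have -> : s^-1 - s'^-1 = (s * s' * (s + s'))^-1.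
  have H : (s' - s) * (s + s') = 1 by transitivity (s' ^+ 2 - s ^+ 2); [ring|rewrite E; ring].
  rewrite invfM -[(s + s')^-1]mul1r -H mulfK; last by rewrite gt_eqF// addr_gt0.
  by field; rewrite !gt_eqF.
have p0 : 0 < s * s' * (s + s') by rewrite !mulr_gt0// addr_gt0.
apply/andP; split.
  rewrite -invfM lef_pV2 ?posrE ?p0 ?mulr_gt0 ?exprn_gt0//.
  have -> : s ^+ 3 * 6 = s * (2 * s) * (s + 2 * s) by ring.
  apply: ler_pM; [by apply: mulr_ge0; apply: ltW|by apply: addr_ge0; apply: ltW| |].
    by rewrite ler_pM2l.
  by rewrite lerD2l.
have -> : 2 * (s' ^+ 3)^-1 = (s' ^+ 3 / 2)^-1 by field; rewrite gt_eqF.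
rewrite lef_pV2 ?posrE ?p0 ?mulr_gt0 ?invr_gt0 ?exprn_gt0//.
have : s' * s' * s' <= 2 * s * s' * (s + s').
  apply: ler_pM; [by apply: mulr_ge0; apply: ltW|exact: ltW| |lra].
  by rewrite ler_pM2r.
have -> : s' ^+ 3 = s' * s' * s' by ring.
lra.
Qed.

Context (f : nat -> R).
Context (f_ge0 : forall n, (0 < n)%N -> 0 <= f n).
Context (f_homo : forall m n, (0 < m)%N -> (m <= n)%N -> f m <= f n).

Definition weight (k : nat) : R := f k / sqrtn k ^+ 3.

Definition increment (k : nat) : R := (f k.+1 - f k) / sqrtn k.

Lemma weight_ge0 k : (0 < k)%N -> 0 <= weight k.
Proof. by move=> k0; rewrite divr_ge0 ?f_ge0 ?exprn_ge0 ?sqrtn_ge0. Qed.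

Lemma increment_ge0 k : (0 < k)%N -> 0 <= increment k.
Proof. by move=> k0; rewrite divr_ge0 ?sqrtn_ge0// subr_ge0 f_homo. Qed.

Lemma sum_nat_ge0 (u : nat -> R) m n : (0 < m)%N ->
  (forall k, (0 < k)%N -> 0 <= u k) -> 0 <= \sum_(m <= k < n) u k.
Proof.
move=> m0 u0; rewrite big_nat_cond; apply: sumr_ge0 => k /andP[/andP[mk _] _].
exact/u0/(leq_trans m0).
Qed.

Lemma sum_nat_sub (u : nat -> R) m m' n n' : (0 < m)%N -> (m <= m')%N ->
  (m' <= n')%N -> (n' <= n)%N -> (forall k, (0 < k)%N -> 0 <= u k) ->
  \sum_(m' <= k < n') u k <= \sum_(m <= k < n) u k.
Proof.
move=> m0 mm' mn' nn' u0.
rewrite (big_cat_nat (n := m') mm') /=; last exact: leq_trans nn'.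
rewrite [X in _ <= _ + X](big_cat_nat (n := n') mn')//=.
have := sum_nat_ge0 m' m0 u0.
have := sum_nat_ge0 n (leq_trans m0 (leq_trans mm' mn')) u0; lra.
Qed.

(** By monotonicity each of the [n] terms of the dyadic block is at least [f n / (4 * n * sqrtn n)].
    This bounds the boundary term of Abel summation and shows that f(n) is small compared to sqrt n
    when the tail is small. *)
Lemma value_le_weights n : (0 < n)%N ->
  f n / sqrtn n <= 4 * \sum_(n <= k < n.*2) weight k.
Proof.
move=> n0; have s0 := sqrtn_gt0 n0.
have N0 : 0 < n%:R :> R by rewrite ltr0n.
have : \sum_(n <= k < n.*2) f n / (2 * n%:R * (2 * sqrtn n)) <=
  \sum_(n <= k < n.*2) weight k.
  rewrite big_nat_cond [leRHS]big_nat_cond; apply: ler_sum => k /andP[/andP[nk kn] _].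
  have k0 := leq_trans n0 nk.
  rewrite /weight; apply: ler_pM => //; first exact: f_ge0.
  - by rewrite invr_ge0 !mulr_ge0 ?sqrtn_ge0.
  - exact: f_homo.
  rewrite lef_pV2 ?posrE ?mulr_gt0 ?exprn_gt0 ?sqrtn_gt0//.
  rewrite exprSr sqrtn_sq ler_pM ?sqrtn_ge0//.
    by rewrite -natrM ler_nat mul2n ltnW.
  exact/(le_trans _ (sqrtn_double n))/sqrtn_le/ltnW.
rewrite sumr_const_nat -addnn addnK -[_ *+ n]mulr_natr.
have -> : f n / (2 * n%:R * (2 * sqrtn n)) * n%:R = f n / sqrtn n / 4.
  by field; rewrite !gt_eqF.
lra.
Qed.

Lemma increments_le_weights m n : (0 < m)%N -> (m <= n)%N ->
  \sum_(m <= k < n) increment k <= 6 * \sum_(m <= k < n.*2) weight k.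
Proof.
move=> m0 mn.
(* Abel summation; the boundary term [f n / sqrtn n] is afterwards absorbed into the block from [n]
   to [n.*2], whence 6 = 4 + 2. *)
have H : \sum_(m <= k < n) increment k <=
    f n / sqrtn n + 2 * \sum_(m <= k < n) weight k.+1.
  elim: n mn => [|n IHn] mn.
    by move: mn; rewrite leqn0 => /eqP m00; rewrite m00 in m0.
  move: mn; rewrite leq_eqVlt => /predU1P[<-|mn].
    by rewrite !big_geq// mulr0 addr0 divr_ge0 ?sqrtn_ge0 ?f_ge0.
  have n0 : (0 < n)%N by exact: leq_trans m0 mn.
  rewrite !big_nat_recr//=; have := IHn mn.
  have /andP[_] := sqrtn_diff n0.
  move=> /(ler_wpM2l (f_ge0 (ltn0Sn n))); rewrite /increment /weight.
  lra.
have := value_le_weights (leq_trans m0 mn).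
have : \sum_(m <= k < n) weight k.+1 <= \sum_(m <= k < n.*2) weight k.
  have := @big_add1 R 0 +%R m n.+1 xpredT weight; rewrite /= => <-.
  apply: sum_nat_sub => //; last exact: weight_ge0.
  by rewrite -addnn -addn1 leq_add2l (leq_trans m0).
have : \sum_(n <= k < n.*2) weight k <= \sum_(m <= k < n.*2) weight k.
  apply: sum_nat_sub => //; last exact: weight_ge0.
  by rewrite -addnn leq_addr.
lra.
Qed.

Lemma weights_le_increments n : (0 < n)%N ->
  \sum_(1 <= k < n) weight k <= 6 * (f 1%N + \sum_(1 <= k < n) increment k).
Proof.
move=> n0.
(* The nonnegative boundary term is added on the left to make the induction close. *)
suff : \sum_(1 <= k < n) weight k / 6 + f n / sqrtn n <=
    f 1%N + \sum_(1 <= k < n) increment k.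
  have : 0 <= f n / sqrtn n by rewrite divr_ge0 ?sqrtn_ge0 ?f_ge0.
  by rewrite -mulr_suml; lra.
elim: n n0 => // -[|n] IHn _.
  by rewrite !big_geq// add0r addr0 /sqrtn sqrtr1 divr1.
rewrite [in leLHS]big_nat_recr//= [in leRHS]big_nat_recr//=; have := IHn isT.
have n0 : (0 < n.+1)%N by [].
have /andP[+ _] := sqrtn_diff n0 => /(ler_wpM2l (f_ge0 n0)).
have : (f n.+2 - f n.+1) / sqrtn n.+2 <= increment n.+1.
  apply: ler_wpM2l; first by rewrite subr_ge0 f_homo.
  by rewrite lef_pV2 ?posrE ?sqrtn_gt0// sqrtn_le.
rewrite /weight; lra.
Qed.

End AbelSummation.

(** * Convergence of nonnegative series through partial sums *)

Section NonnegativeSeries.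
Context (R : realType) (u : nat -> R).
Context (u_ge0 : forall n, (0 < n)%N -> 0 <= u n).

Lemma nneseries_ltyP : (\sum_(1 <= n <oo) (u n)%:E < +oo)%E <->
  exists M, forall n, \sum_(1 <= k < n) u k <= M.
Proof.
have u0 n : (1 <= n)%N -> true -> (0 <= (u n)%:E)%E.
  by move=> n1 _; rewrite lee_fin u_ge0.
split => [uoo|[M HM]].
  exists (fine (\sum_(1 <= n <oo) (u n)%:E)%E) => n.
  rewrite -lee_fin fineK; last by rewrite ge0_fin_numE// nneseries_ge0.
  by rewrite -sumEFin; apply: nneseries_lim_ge => k k1 _; exact: u0.
apply: le_lt_trans (ltry M); apply: lime_le; first exact: is_cvg_nneseries.
by apply: nearW => n; rewrite sumEFin lee_fin.
Qed.

Lemma small_tail : (exists M, forall n, \sum_(1 <= k < n) u k <= M) ->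
  forall e, 0 < e -> exists2 m, (0 < m)%N & 
    forall n, \sum_(m <= k < n) u k <= e.
Proof.
move=> [M HM] e e0.
pose S := range (fun n => \sum_(1 <= k < n) u k).
have supS : has_sup S.
  split; first by exists (\sum_(1 <= k < 0) u k); exists 0%N.
  by exists M => _ [n _ <-].
have [_ [m _ <-] Hm] := sup_adherent e0 supS.
exists (maxn 1 m) => [|n]; first by rewrite leq_max.
have [nm|mn] := leqP n (maxn 1 m); first by rewrite big_geq// ltW.
have : \sum_(1 <= k < n) u k <= sup S by apply: sup_ubound supS.2 _ _; exists n.
have m1 : (1 <= maxn 1 m)%N by rewrite leq_max.
rewrite (big_cat_nat (n := maxn 1 m))//=; last exact: ltnW.
have -> : \sum_(1 <= k < maxn 1 m) u k = \sum_(1 <= k < m) u k.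
  by case: (m) => [|m']; [rewrite !big_geq|rewrite (maxn_idPr _)].
move: Hm; lra.
Qed.

End NonnegativeSeries.

(** * Moving barriers *)

Section Barriers.
Context (R : realType) (mu : probability R R).
Context (sq_int : mu.-integrable setT (EFin \o (fun z : R => z ^+ 2))).
Context (mean0 : avg mu id = 0) (nondeg : 0 < trunc_var mu).
Local Notation avg := (avg mu).
Local Notation stay := (stay mu).
Local Notation step := (step mu).
Local Notation free := (@free R).
Local Notation sqrtn := (@sqrtn R).
Local Notation pos := (@pos R).
Local Hint Resolve upward_free : core.

Definition prob p n := stay p n (fun=> 1).

(** Vacuous before [n0], so that [barrier 1 b] leaves time 0 free and never looks at [b 0]. *)
Definition barrier (n0 : nat) (b : nat -> R) (k : nat) (x : R) :=
  (n0 <= k)%N ==> (b k <= x).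

Lemma upward_barrier n0 b k : upward (barrier n0 b k).
Proof.
move=> x y xy; rewrite /barrier; case: (n0 <= k)%N => //=.
by move=> bx; exact: le_trans xy.
Qed.
Local Hint Resolve upward_barrier : core.

Lemma barrierP n0 b k x : (n0 <= k)%N -> barrier n0 b k x = (b k <= x).
Proof. by rewrite /barrier => ->. Qed.

Lemma prob_ge0 p n : (forall k, upward (p k)) -> 0 <= prob p n.
Proof. by move=> up; apply: stay_ge0 => //; exact: quad_growth_cst. Qed.

Lemma step_le_avg p g x : upward p -> quad_growth g -> (forall y, 0 <= g y) ->
  step p g x <= avg (fun z => g (x + z)).
Proof.
move=> up qg g0; apply: le_avg => //.
- exact/quad_growth_shiftl/quad_growth_cut.
- exact: quad_growth_shiftl.
- by move=> z; rewrite /cut; case: (p _); rewrite /= ?mul1r ?mul0r.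
Qed.

(** Killing replaces values that are at most 0 by 0; this turns submartingale inequalities of the
    free walk into inequalities for the killed one. *)
Lemma step_ge_avg p g x : upward p -> quad_growth g ->
  (forall y, ~~ p y -> g y <= 0) -> avg (fun z => g (x + z)) <= step p g x.
Proof.
move=> up qg g0; apply: le_avg => //.
- exact: quad_growth_shiftl.
- exact/quad_growth_shiftl/quad_growth_cut.
- by move=> z; rewrite /cut; case E: (p (x + z)) => /=;
    rewrite ?mul1r ?mul0r// g0// E.
Qed.

(** Harris' inequality against the sure event: survival and a nondecreasing function of the endpoint
    are positively correlated. *)
Lemma stay_free_le p n g : (forall k, upward (p k)) -> lin_growth g ->
  (forall x, 0 <= g x) -> {homo g : x y / x <= y} ->
  stay free n g * prob p n <= stay p n g.
Proof.
move=> up lg g0 ndg.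
have -> : g = (fun x => g x * 1) by apply/funext => x; rewrite mulr1.
rewrite {1}(_ : (fun x => g x * 1) = g); last by apply/funext => x; rewrite mulr1.
by apply: stay_harris => //; exact: lin_growth_cst.
Qed.

Lemma eq_stay_barrier p p' n g : (forall k x, (k <= n)%N -> p k x = p' k x) ->
  stay p n g = stay p' n g.
Proof.
elim: n g => [|n IHn] g pp' /=; first by rewrite /cut pp'.
rewrite (_ : p n.+1 = p' n.+1); last by apply/funext => x; exact: pp'.
by apply: IHn => k x kn; apply: pp'; exact: leqW.
Qed.

(** A step adds at most the variance times the survival probability, and the sum of 1 / sqrt k up to
    n is O(sqrt n). *)
Lemma stay_sq_growth p n0 C : (forall k, upward (p k)) -> (0 < n0)%N ->
  (forall n, (n0 <= n)%N -> prob p n <= C / sqrtn n) ->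
  exists2 D, 0 < D &
    forall n, (n0 <= n)%N -> stay p n (fun x => x ^+ 2) <= D * sqrtn n.
Proof.
move=> up n00 HC; have s00 := @sqrtn_gt0 R _ n00.
have qs := @quad_growth_sq R.
have C0 : 0 <= C.
  have := le_trans (prob_ge0 n0 up) (HC n0 (leqnn _)).
  by rewrite pmulr_lge0// invr_gt0.
have v0 := var_ge0 mu; have vC := mulr_ge0 v0 C0.
set S := fun n => stay p n (fun x => x ^+ 2).
have S0 : 0 <= S n0 by apply: stay_ge0 => // x _; exact: sqr_ge0.
(* The first term covers the start, the second comes from 1 / sqrt n <= 3 (sqrt (n+1) - sqrt n), and
   1 ensures positivity. *)
exists (S n0 / sqrtn n0 + 3 * (var mu * C) + 1).
  apply: ltr_wpDl => //; apply: addr_ge0; last exact: mulr_ge0.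
  by apply: divr_ge0 => //; exact: ltW.
elim=> [|n IHn] nn0; first by move: nn0 n00; rewrite leqn0 => /eqP ->.
move: nn0; rewrite leq_eqVlt => /predU1P[<-|nn0].
  rewrite !mulrDl divfK ?gt_eqF// -/(S n0).
  by have := mulr_ge0 vC (ltW s00); lra.
have n_gt0 : (0 < n)%N := leq_trans n00 nn0.
have s0 := @sqrtn_gt0 R _ n_gt0; have ss' := @sqrtn_le R _ _ (leqnSn n).
have s's := @sqrtn_succ R _ n_gt0.
have E : sqrtn n.+1 ^+ 2 = sqrtn n ^+ 2 + 1 by rewrite !sqrtn_sq -natr1.
have H1 : S n.+1 <= S n + var mu * (C / sqrtn n).
  apply: (@le_trans _ _ (S n + var mu * prob p n)); last first.
    by rewrite lerD2l ler_wpM2l// HC.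
  have qc := quad_growth_cst (1 : R).
  rewrite /S /prob -stayZ// -stayD//; last exact: quad_growthZ.
  rewrite /=; apply: stay_le => //.
  - exact: quad_growth_step.
  - by apply: quad_growthD => //; exact: quad_growthZ.
  - move=> x _; rewrite mulr1 -avg_shift_sq//; apply: step_le_avg => // y.
    exact: sqr_ge0.
apply: (le_trans H1); move: (IHn nn0) => {}IHn.
set D := _ + 1 in IHn *.
have H2 : 1 <= 3 * (sqrtn n.+1 - sqrtn n) * sqrtn n by nra.
have H3 : var mu * (C / sqrtn n) <= 3 * (var mu * C) * (sqrtn n.+1 - sqrtn n).
  rewrite [leLHS]mulrA ler_pdivrMr//.
  have -> : 3 * (var mu * C) * (sqrtn n.+1 - sqrtn n) * sqrtn n =
    var mu * C * (3 * (sqrtn n.+1 - sqrtn n) * sqrtn n) by ring.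
  by rewrite ler_peMr.
have H4 : 3 * (var mu * C) * (sqrtn n.+1 - sqrtn n) <= D * (sqrtn n.+1 - sqrtn n).
  rewrite ler_wpM2r ?subr_ge0// /D.
  have : 0 <= S n0 / sqrtn n0 by rewrite divr_ge0// ltW.
  lra.
have : S n <= D * sqrtn n by [].
rewrite -/(S n); lra.
Qed.

(** Cauchy-Schwarz on the survival event, in the form of AM-GM with the parameter [l] at which the
    quadratic term costs exactly [w / 2]. *)
Lemma prob_ge_of_moments p n (w D : R) : (forall k, upward (p k)) -> (0 < n)%N ->
  0 < w -> 0 < D -> w <= stay p n pos -> stay p n (fun x => x ^+ 2) <= D * sqrtn n ->
  w ^+ 2 / D / sqrtn n <= prob p n.
Proof.
move=> up n0 w0 D0 H1 H2; have s0 := @sqrtn_gt0 R _ n0.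
pose l := D * sqrtn n / w; have l0 : 0 < l by rewrite divr_gt0// mulr_gt0.
have qs := @quad_growth_sq R; have qc := quad_growth_cst (1 : R).
have qp : quad_growth pos := lin_quad (lin_growth_pos R).
have : stay p n pos <= stay p n (fun x => l / 2 * 1 + (2 * l)^-1 * x ^+ 2).
  apply: stay_le => //; first by apply: quad_growthD; exact: quad_growthZ.
  move=> x _; have : 0 <= (pos x - l) ^+ 2 / (2 * l).
    by rewrite divr_ge0 ?sqr_ge0// mulr_ge0// ltW.
  have -> : (pos x - l) ^+ 2 / (2 * l) =
      l / 2 * 1 + (2 * l)^-1 * pos x ^+ 2 - pos x by field; rewrite gt_eqF.
  have : (2 * l)^-1 * pos x ^+ 2 <= (2 * l)^-1 * x ^+ 2.
    apply: ler_wpM2l; first by rewrite invr_ge0 mulr_ge0// ltW.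
    by rewrite /pos; case: (lerP x 0) => // _; rewrite expr0n sqr_ge0.
  lra.
rewrite stayD//; [|exact: quad_growthZ..].
rewrite !stayZ// -/(prob p n).
have : (2 * l)^-1 * stay p n (fun x => x ^+ 2) <= (2 * l)^-1 * (D * sqrtn n).
  by rewrite ler_wpM2l// invr_ge0 mulr_ge0// ltW.
have -> : (2 * l)^-1 * (D * sqrtn n) = w / 2 by rewrite /l; field; rewrite !gt_eqF.
have -> : w ^+ 2 / D / sqrtn n = w / l by rewrite /l; field; rewrite !gt_eqF.
rewrite ler_pdivrMr//; lra.
Qed.

Section OneBarrier.
Context (f : nat -> R).
Context (f_ge0 : forall n, (0 < n)%N -> 0 <= f n).
Context (f_homo : forall m n, (0 < m)%N -> (m <= n)%N -> f m <= f n).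

(** Gronwall argument. Lowering the barrier raises [W] by at most [L] times its displacement times
    the survival probability, which [WP] bounds by [W] itself. The case [f = 0] is the zero
    barrier. *)
Lemma prob_lower_barrier_le n0 M : (0 < n0)%N ->
  (forall n, (n0 <= n)%N -> \sum_(n0 <= k < n) increment f k <= M) ->
  exists C, forall n, (n0 <= n)%N ->
    prob (barrier n0 (fun k => - f k)) n <= C / sqrtn n.
Proof.
move=> n00 HM; set p := barrier n0 _.
have up k : upward (p k) by exact: upward_barrier.
have [h [L [[L0 lh ndh] h0 hx hadd hsup]]] := superharmonic_exists sq_int mean0 nondeg.
have [c c0 Hc] := stay_free_pos sq_int mean0 nondeg.
have qc := quad_growth_cst (1 : R).
pose W n := stay p n (fun x => h (x + f n)).
have qh n : quad_growth (fun x => h (x + f n)).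
  exact/lin_quad/lin_growth_shift.
have W0 n : 0 <= W n by apply: stay_ge0.
have WP n : (n0 <= n)%N -> c * sqrtn n * prob p n <= W n.
  move=> nn0; have n_gt0 := leq_trans n00 nn0.
  apply: (@le_trans _ _ (stay free n pos * prob p n)).
    by rewrite ler_wpM2r ?prob_ge0// Hc.
  apply: (@le_trans _ _ (stay p n pos)).
    apply: stay_free_le => //;
      [exact: lin_growth_pos|exact: pos_ge0|exact: pos_homo].
  apply: stay_le => //; first exact/lin_quad/lin_growth_pos.
  move=> x _; rewrite /pos ge_max h0 andbT; apply: (le_trans (hx x)).
  by apply: ndh; rewrite lerDl f_ge0.
have Wstep n : (n0 <= n)%N -> W n.+1 <= W n * (1 + L / c * increment f n).
  move=> nn0; have n_gt0 := leq_trans n00 nn0; have s0 := @sqrtn_gt0 R _ n_gt0.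
  have D0 : 0 <= f n.+1 - f n by rewrite subr_ge0 f_homo.
  have : W n.+1 <= W n + L * (f n.+1 - f n) * prob p n.
    rewrite /W /prob -stayZ// -stayD//; last exact: quad_growthZ.
    rewrite /=; apply: stay_le => //.
    - exact: quad_growth_step.
    - by apply: quad_growthD => //; exact: quad_growthZ.
    - move=> x; rewrite /p barrierP// => px; rewrite mulr1.
      apply: le_trans (step_le_avg x (up _) (qh _) _) _ => //.
      under eq_fun do rewrite addrAC.
      have xf : 0 <= x + f n by rewrite -lerBlDr sub0r.
      have := hadd (x + f n) (f n.+1 - f n) xf D0.
      have -> : x + f n + (f n.+1 - f n) = x + f n.+1 by ring.
      move=> /andP[_]; apply: le_trans; apply: hsup.
      by have := f_homo n_gt0 (leqnSn n); lra.
  move=> /le_trans; apply.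
  rewrite /increment.
  have -> : W n * (1 + L / c * ((f n.+1 - f n) / sqrtn n)) =
    W n + L * (f n.+1 - f n) * (W n / (c * sqrtn n)) by field; rewrite !gt_eqF.
  rewrite lerD2l ler_wpM2l ?mulr_ge0// ler_pdivlMr ?mulr_gt0// mulrC.
  exact: WP.
have Lc : 0 <= L / c by rewrite divr_ge0// ltW.
have WB n : (n0 <= n)%N ->
    W n <= W n0 * expR (L / c * \sum_(n0 <= k < n) increment f k).
  elim: n => [|n IHn] nn0; first by move: nn0 n00; rewrite leqn0 => /eqP ->.
  move: nn0; rewrite leq_eqVlt => /predU1P[<-|nn0].
    by rewrite big_geq// mulr0 expR0 mulr1.
  rewrite big_nat_recr//= mulrDr expRD mulrA.
  apply: (le_trans (Wstep _ nn0)); apply: ler_pM => //.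
  - by rewrite addr_ge0// mulr_ge0// increment_ge0// (leq_trans n00).
  - exact: IHn.
  - exact: expR_ge1Dx.
exists (W n0 * expR (L / c * M) / c) => n nn0.
have s0 := @sqrtn_gt0 R _ (leq_trans n00 nn0).
rewrite ler_pdivlMr// ler_pdivlMr//.
have -> : prob p n * sqrtn n * c = c * sqrtn n * prob p n by ring.
apply: (le_trans (WP _ nn0)); apply: (le_trans (WB _ nn0)).
by rewrite ler_wpM2l// ler_expR ler_wpM2l// HM.
Qed.

End OneBarrier.

Lemma prob_zero_barrier_le n0 : (0 < n0)%N -> exists C, forall n, (n0 <= n)%N ->
  prob (barrier n0 (fun=> 0)) n <= C / sqrtn n.
Proof.
move=> n00; have := @prob_lower_barrier_le (fun=> 0) _ _ n0 0 n00.
rewrite oppr0; apply=> // n nn0.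
by rewrite big1// => k _; rewrite /increment subrr mul0r.
Qed.

Section OneBarrier.
Context (f : nat -> R).
Context (f_ge0 : forall n, (0 < n)%N -> 0 <= f n).
Context (f_homo : forall m n, (0 < m)%N -> (m <= n)%N -> f m <= f n).

Lemma stay_barrier_start n0 b g : quad_growth g ->
  (forall x, x < b n0 -> g x = 0) -> stay (barrier n0 b) n0 g = stay free n0 g.
Proof.
case: n0 => [|m] qg g0 /=.
  rewrite /cut barrierP//; case: (lerP (b 0%N) 0) => //= b0.
  by rewrite g0// !mulr0.
rewrite (@eq_stay_barrier _ free); last first.
  by move=> k x km; rewrite /barrier ltnNge km.
congr (stay _ _ _); apply/funext => x; rewrite /step.
congr (avg _); apply/funext => z; rewrite /cut barrierP//.
by case: (lerP (b m.+1) (x + z)) => //= b0; rewrite g0// !mulr0.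
Qed.

(** The start [n0] is taken so late that all later rises of the barrier together destroy at most
    half of [W n0]; first and second moments then bound the probability from below. *)
Lemma prob_upper_barrier_ge M : (forall n, \sum_(1 <= k < n) weight f k <= M) ->
  exists n0 c, [/\ (0 < n0)%N, 0 < c &
    forall n, (n0 <= n)%N -> c / sqrtn n <= prob (barrier n0 f) n].
Proof.
move=> HM; have [c c0 Hc] := stay_free_pos sq_int mean0 nondeg.
have {}Hc n : c * sqrtn n <= stay free n pos := Hc n.
have w_ge0 := weight_ge0 f_ge0.
(* A tail of at most [c / 24] keeps the sum of increments below [6 * (c / 24) = c / 4], and the
   factor [2 / c] in [Wstep] turns this into 1/2. *)
have [n0 n00 Hn0] := small_tail (ex_intro _ M HM) (divr_gt0 c0 (ltr0Sn R 23)).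
have lp := lin_growth_pos R; have qp := lin_quad lp.
have qs := @quad_growth_sq R; have qc := quad_growth_cst (1 : R).
pose p := barrier n0 f; have up k : upward (p k) by exact: upward_barrier.
have Hf n : (n0 <= n)%N -> f n <= c / 2 * sqrtn n.
  move=> nn0; have n_gt0 := leq_trans n00 nn0.
  rewrite -ler_pdivrMr ?sqrtn_gt0//; apply: le_trans (value_le_weights f_ge0 f_homo n_gt0) _.
  have : \sum_(n <= k < n.*2) weight f k <= \sum_(n0 <= k < n.*2) weight f k.
    by apply: sum_nat_sub => //; rewrite -addnn leq_addr.
  have := Hn0 n.*2; lra.
have Hi n : (n0 <= n)%N -> \sum_(n0 <= k < n) increment f k <= c / 4.
  move=> nn0; apply: le_trans (increments_le_weights f_ge0 f_homo n00 nn0) _.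
  have := Hn0 n.*2; lra.
pose W n := stay p n (fun x => pos (x - f n)).
have qW n : quad_growth (fun x => pos (x - f n)).
  exact/lin_quad/(lin_growth_shift (- f n)).
have WP n : (n0 <= n)%N -> c / 2 * sqrtn n * prob p n <= W n.
  move=> nn0; have P0 := prob_ge0 n up.
  have H1 : stay p n pos <= W n + f n * prob p n.
    rewrite /W /prob -stayZ// -stayD//; last exact: quad_growthZ.
    apply: stay_le => //; first by apply: quad_growthD => //; exact: quad_growthZ.
    move=> x _; have /andP[] := pos_subr x (f_ge0 (leq_trans n00 nn0)); lra.
  have := stay_free_le n up lp (@pos_ge0 R) (@pos_homo R).
  have := ler_wpM2r P0 (Hc n); have := ler_wpM2r P0 (Hf n nn0); lra.
have W0 n : 0 <= W n by apply: stay_ge0 => // x _; exact: pos_ge0.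
have Wstep n : (n0 <= n)%N -> W n * (1 - 2 / c * increment f n) <= W n.+1.
  move=> nn0; have n_gt0 := leq_trans n00 nn0; have s0 := @sqrtn_gt0 R _ n_gt0.
  have D0 : 0 <= f n.+1 - f n by rewrite subr_ge0 f_homo.
  have : W n <= W n.+1 + (f n.+1 - f n) * prob p n.
    rewrite /W /prob -stayZ// /= -stayD//; [|exact: quad_growth_step|exact: quad_growthZ].
    apply: stay_le => //.
      by apply: quad_growthD; [exact: quad_growth_step|exact: quad_growthZ].
    move=> x; rewrite /p barrierP// => px; rewrite mulr1 pos_id ?subr_ge0//.
    rewrite -lerBlDr; apply: le_trans (step_ge_avg _ _ _ _) => //; last first.
      move=> y; rewrite barrierP; last exact: leqW.
      by rewrite -ltNge => yf; rewrite /pos max_r//; lra.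
    apply: (@le_trans _ _ (avg (fun z => (x - f n.+1) + z))).
      by rewrite avg_shift_id//; lra.
    apply: le_avg => //; last by move=> z; rewrite addrAC; exact: le_pos.
      by apply: quad_growthD; [exact: quad_growth_cst|exact/lin_quad/lin_growth_id].
    exact: (quad_growth_shiftl x (qW n.+1)).
  have : (f n.+1 - f n) * prob p n <= (f n.+1 - f n) * (W n / (c / 2 * sqrtn n)).
    have h0 : 0 < c / 2 * sqrtn n by rewrite mulr_gt0// divr_gt0.
    by rewrite ler_wpM2l// ler_pdivlMr// mulrC WP.
  have -> : (f n.+1 - f n) * (W n / (c / 2 * sqrtn n)) = W n * (2 / c * increment f n).
    by rewrite /increment; field; rewrite !gt_eqF.
  lra.
(* A product of factors 1 - a_k is at least 1 minus the sum of the a_k; the total of 1/2 keeps every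
   factor nonnegative. *)
have WB n : (n0 <= n)%N ->
    W n0 * (1 - 2 / c * \sum_(n0 <= k < n) increment f k) <= W n.
  elim: n => [|n IHn] nn0; first by move: nn0 n00; rewrite leqn0 => /eqP ->.
  move: nn0; rewrite leq_eqVlt => /predU1P[<-|nn0].
    by rewrite big_geq// mulr0 subr0 mulr1.
  have i0 := increment_ge0 f_homo (leq_trans n00 nn0).
  have s0 : 0 <= \sum_(n0 <= k < n) increment f k.
    by apply: sum_nat_ge0 => //; exact: increment_ge0.
  have := Hi n.+1 (leqW nn0); rewrite big_nat_recr//= => Hin.
  apply: le_trans (Wstep _ nn0).
  have c2 : 0 < 2 / c by rewrite divr_gt0.
  have := ler_wpM2l (ltW c2) Hin; rewrite mulrDr.
  have -> : 2 / c * (c / 4) = 1 / 2 by field; rewrite gt_eqF.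
  have := mulr_ge0 (ltW c2) i0; have := mulr_ge0 (ltW c2) s0.
  move: (2 / c * increment f n) (2 / c * \sum_(n0 <= k < n) increment f k) (IHn nn0).
  move=> a b H b0 a0 ab.
  have a1 : 0 <= 1 - a by lra.
  have := ler_wpM2r a1 H.
  by apply: le_trans; have := mulr_ge0 (W0 n0) (mulr_ge0 a0 b0); lra.
have s00 := @sqrtn_gt0 R _ n00.
have Wn0 : 0 < W n0.
  rewrite /W stay_barrier_start//; last by move=> x xf; rewrite /pos max_r//; lra.
  apply: (@lt_le_trans _ _ (stay free n0 pos - f n0)).
    by have := Hc n0; have := Hf _ (leqnn n0); have := mulr_gt0 c0 s00; lra.
  have qcf : quad_growth (fun _ : R => f n0) by exact: quad_growth_cst.
  rewrite lerBlDr -[leRHS](addrC (f n0)) -{1}(stay_free_cst mu n0 (f n0)) -stayD//.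
  apply: stay_le => //; first exact: quad_growthD.
  by move=> x _; have /andP[] := pos_subr x (f_ge0 n00); lra.
have WL n : (n0 <= n)%N -> W n0 / 2 <= stay p n pos.
  move=> nn0; apply: (@le_trans _ _ (W n)).
    apply: le_trans (WB _ nn0); rewrite ler_pM2l//.
    have c2 : 0 < 2 / c by rewrite divr_gt0.
    have := ler_wpM2l (ltW c2) (Hi n nn0).
    have -> : 2 / c * (c / 4) = 1 / 2 by field; rewrite gt_eqF.
    by lra.
  apply: stay_le => // x _.
  by have /andP[] := pos_subr x (f_ge0 (leq_trans n00 nn0)).
(* Staying above [f] implies staying above 0; this upper bound is the input of the second-moment
   estimate. *)
have [C HC] : exists C, forall n, (n0 <= n)%N -> prob p n <= C / sqrtn n.
  have [C HC] := @prob_zero_barrier_le n0 n00.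
  exists C => n nn0; apply: le_trans (HC n nn0).
  apply: stay_sub => // k x _; rewrite /p /barrier; case: leqP => //= kn0.
  by apply: le_trans; apply: f_ge0; exact: leq_trans kn0.
have [D D0 HD] := stay_sq_growth up n00 HC.
exists n0, ((W n0 / 2) ^+ 2 / D); split => //.
  by rewrite divr_gt0// exprn_gt0// divr_gt0.
move=> n nn0; apply: prob_ge_of_moments => //;
  [exact: leq_trans nn0|exact: divr_gt0|exact: WL|exact: HD].
Qed.

Lemma increments_bounded_weights n0 M : (0 < n0)%N ->
  (forall n, (n0 <= n)%N -> \sum_(n0 <= k < n) increment f k <= M) ->
  exists M', forall n, \sum_(1 <= k < n) weight f k <= M'.
Proof.
move=> n00 HM; have i_ge0 := increment_ge0 f_homo.
exists (6 * (f 1%N + (\sum_(1 <= k < n0) increment f k + M))) => n.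
have [n_gt0|] := ltnP 0 (maxn n n0); last by rewrite leqNgt leq_max n00 orbT.
apply: (@le_trans _ _ (\sum_(1 <= k < maxn n n0) weight f k)).
  case: n n_gt0 => [|n] n_gt0; last first.
    by apply: sum_nat_sub => //; [exact: leq_maxl|exact: weight_ge0].
  by rewrite big_geq//; apply: sum_nat_ge0 => //; exact: weight_ge0.
apply: le_trans (weights_le_increments f_ge0 f_homo n_gt0) _.
rewrite ler_pM2l// lerD2l (big_cat_nat (n := n0))//=; last exact: leq_maxr.
by rewrite lerD2l HM// leq_maxr.
Qed.

(** For the reduced barrier [eps * f], the walk survives and lies above the next level with
    probability at least a constant over sqrt n. There each rise takes at least its height from [W],
    as [h] has slope at least 1, and [W] cannot become negative. *)
Lemma weights_bounded_of_upper n0 c : (0 < n0)%N -> 0 < c ->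
  (forall n, (n0 <= n)%N -> c / sqrtn n <= prob (barrier n0 f) n) ->
  exists M, forall n, \sum_(1 <= k < n) weight f k <= M.
Proof.
move=> n00 c0 HP.
have [h [L [[L0 lh ndh] h0 hx hadd hsup]]] := superharmonic_exists sq_int mean0 nondeg.
have qs := @quad_growth_sq R; have qc := quad_growth_cst (1 : R).
pose p0 := barrier n0 (fun=> 0); have up0 k : upward (p0 k) by exact: upward_barrier.
pose p := barrier n0 f; have up k : upward (p k) by exact: upward_barrier.
have [C HC] := prob_zero_barrier_le n00.
have [D D0 HD] := stay_sq_growth up0 n00 HC.
pose G := 1 + D / c; have G0 : 0 < G by rewrite addr_gt0// divr_gt0.
(* On survival S_n^2 is at least f(n)^2, while its mean on the larger event of staying nonnegative
   is O(sqrt n). *)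
have HG n : (n0 <= n)%N -> f n <= G * sqrtn n.
  move=> nn0; have n_gt0 := leq_trans n00 nn0; have s0 := @sqrtn_gt0 R _ n_gt0.
  have f0 := f_ge0 n_gt0.
  have : f n ^+ 2 * prob p n <= D * sqrtn n.
    apply: le_trans (HD n nn0); rewrite /prob -stayZ//.
    apply: (@le_trans _ _ (stay p n (fun x => x ^+ 2))).
      apply: stay_le => //; first exact: quad_growthZ.
      move=> x; rewrite /p barrierP// mulr1 => fx.
      by rewrite lerXn2r ?nnegrE// (le_trans f0).
    apply: stay_sub => // [k x kn|x]; last exact: sqr_ge0.
    rewrite /p /p0 /barrier; case: leqP => //= kn0.
    by apply: le_trans; apply: f_ge0; exact: leq_trans kn0.
  have := ler_wpM2l (sqr_ge0 (f n)) (HP n nn0) => /le_trans/[apply].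
  rewrite mulrA ler_pdivrMr// => H.
  have {}H : f n ^+ 2 <= D / c * sqrtn n ^+ 2 by rewrite mulrAC ler_pdivlMr//; lra.
  have Gs : 0 < G * sqrtn n by rewrite mulr_gt0.
  rewrite -ler_sqr ?nnegrE ?(ltW Gs)//; apply: (le_trans H).
  rewrite exprMn ler_wpM2r ?sqr_ge0// /G.
  have : 0 < D / c by rewrite divr_gt0.
  by nra.
have [a [c2 [a0 c20 Ha]]] := stay_free_tail sq_int mean0 nondeg.
(* Since [sqrtn n.+1 <= 2 * sqrtn n], this puts [eps * f n.+1] below [a * sqrtn n], the range of
   [stay_free_tail]. *)
pose eps := Num.min 1 (a / (2 * G)).
have e0 : 0 < eps by rewrite lt_min ltr01 divr_gt0// mulr_gt0.
have e1 : eps <= 1 by rewrite ge_min lexx.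
have eG : eps * G <= a / 2.
  rewrite -ler_pdivlMr//; have -> : a / 2 / G = a / (2 * G) by field; rewrite gt_eqF.
  by rewrite ge_min lexx orbT.
pose q := barrier n0 (fun k => eps * f k).
have uq k : upward (q k) by exact: upward_barrier.
pose W n := stay q n (fun x => h (x - eps * f n)).
have qh n : quad_growth (fun x => h (x - eps * f n)).
  exact/lin_quad/(lin_growth_shift (- (eps * f n))).
have W0 n : 0 <= W n by apply: stay_ge0 => // x _; exact: h0.
have qi n : quad_growth (fun x : R => (eps * f n <= x)%R%:R).
  exact/lin_quad/lin_growth_indic/upward_ge.
have Wstep n : (n0 <= n)%N -> W n.+1 + eps * c2 * c * increment f n <= W n.
  move=> nn0; have n_gt0 := leq_trans n00 nn0; have s0 := @sqrtn_gt0 R _ n_gt0.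
  have D1 : 0 <= f n.+1 - f n by rewrite subr_ge0 f_homo.
  have fn0 := f_ge0 n_gt0; have fn1 := f_ge0 (ltn0Sn n).
  have : W n.+1 + eps * (f n.+1 - f n) *
      stay q n (fun x => (eps * f n.+1 <= x)%R%:R) <= W n.
    rewrite /W -stayZ// /= -stayD//; [|exact: quad_growth_step|exact: quad_growthZ].
    apply: stay_le => //.
      by apply: quad_growthD; [exact: quad_growth_step|exact: quad_growthZ].
    move=> x; rewrite /q barrierP// => qx.
    have xf : 0 <= x - eps * f n by rewrite subr_ge0.
    have := step_le_avg x (uq n.+1) (qh n.+1) (fun y => h0 _).
    under [in leRHS]eq_fun do rewrite addrAC.
    case: (lerP (eps * f n.+1) x) => fx /=.
      have := hsup (x - eps * f n.+1); rewrite subr_ge0 => /(_ fx).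
      have := hadd (x - eps * f n.+1) (eps * (f n.+1 - f n)).
      rewrite subr_ge0 => /(_ fx (mulr_ge0 (ltW e0) D1)) /andP[].
      have -> : x - eps * f n.+1 + eps * (f n.+1 - f n) = x - eps * f n by ring.
      lra.
    have : avg (fun z => h (x - eps * f n.+1 + z)) <= avg (fun z => h (0 + z)).
      apply: le_avg => //.
      - exact/quad_growth_shiftl/lin_quad.
      - exact/quad_growth_shiftl/lin_quad.
      - by move=> z; apply: ndh; rewrite lerD2r; lra.
    have := hsup 0 (lexx 0); have : h 0 <= h (x - eps * f n) by exact: ndh.
    lra.
  have : c2 * (c / sqrtn n) <= stay q n (fun x => (eps * f n.+1 <= x)%R%:R).
    apply: (@le_trans _ _ (stay free n (fun x => (eps * f n.+1 <= x)%R%:R) * prob q n)).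
      apply: ler_pM.
      - exact: ltW.
      - by rewrite divr_ge0// ltW.
      - apply: Ha => //; have := HG _ (leqW nn0); have := @sqrtn_succ R _ n_gt0.
        have : 0 <= sqrtn n.+1 by exact: sqrtn_ge0.
        rewrite -/(sqrtn n) => s1 s2 H.
        have := ler_wpM2l (ltW e0) H; have := ler_wpM2r s1 eG; have := ler_wpM2l (ltW a0) s2.
        lra.
      - apply: le_trans (HP n nn0) _; apply: stay_sub => // k x kn.
        rewrite /q /barrier; case: leqP => //= kn0.
        apply: le_trans; have := f_ge0 (leq_trans n00 kn0); nra.
    apply: stay_free_le => //.
    - exact/lin_growth_indic/upward_ge.
    - move=> x y xy; have := @upward_ge _ (eps * f n.+1) _ _ xy.
      case: (lerP (eps * f n.+1) x) => /= _; case: (lerP (eps * f n.+1) y) => //= _.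
      by move=> /(_ isT).
  have ed : 0 <= eps * (f n.+1 - f n) by rewrite mulr_ge0// ltW.
  move=> /(ler_wpM2l ed).
  have -> : eps * (f n.+1 - f n) * (c2 * (c / sqrtn n)) = eps * c2 * c * increment f n.
    by rewrite /increment; ring.
  lra.
have WB n : (n0 <= n)%N ->
    W n + eps * c2 * c * \sum_(n0 <= k < n) increment f k <= W n0.
  elim: n => [|n IHn] nn0; first by move: nn0 n00; rewrite leqn0 => /eqP ->.
  move: nn0; rewrite leq_eqVlt => /predU1P[<-|nn0].
    by rewrite big_geq// mulr0 addr0.
  rewrite big_nat_recr//= mulrDr; have := Wstep n nn0; have := IHn nn0; lra.
apply: (@increments_bounded_weights n0 (W n0 / (eps * c2 * c))) => // n nn0.
rewrite ler_pdivlMr ?mulr_gt0// mulrC.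
by have := WB n nn0; have := W0 n; lra.
Qed.

End OneBarrier.

(* Second moment method for the walk killed below [- a]. *)
Lemma prob_constant_barrier_ge a n : 0 < a ->
  a ^+ 2 / (a ^+ 2 + n%:R * var mu) <= prob (fun _ x => - a <= x) n.
Proof.
move=> a0; pose p (k : nat) (x : R) := - a <= x.
have up k : upward (p k) by exact: upward_ge.
have qs := @quad_growth_sq R; have qc := @quad_growth_cst R.
have qi : quad_growth (@id R) by exact/lin_quad/lin_growth_id.
have qa : quad_growth (fun x => x + a) by exact: quad_growthD.
have qa2 : quad_growth (fun x => (x + a) ^+ 2) by exact: (quad_growth_shift a qs).
have H1 : a <= stay p n (fun x => x + a).
  elim: n => [|n IHn] /=; first by rewrite /cut /p oppr_le0 (ltW a0) mul1r add0r.
  apply: (le_trans IHn); apply: stay_le => //; first exact: quad_growth_step.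
  move=> x _; apply: le_trans (step_ge_avg _ (up _) qa _); last first.
    by move=> y; rewrite /p -ltNge; lra.
  under eq_fun do rewrite addrAC.
  by rewrite avg_shift_id.
have H2 : stay p n (fun x => (x + a) ^+ 2) <= a ^+ 2 + n%:R * var mu.
  elim: n {H1} => [|n IHn] /=.
    by rewrite /cut /p oppr_le0 (ltW a0) mul1r add0r mul0r addr0.
  have P1 : prob p n <= 1.
    by rewrite -[leRHS](stay_free_cst mu n 1); apply: stay_sub.
  apply: (@le_trans _ _ (stay p n (fun x => (x + a) ^+ 2 + var mu * 1))).
    apply: stay_le => //; [exact: quad_growth_step|exact: quad_growthD|].
    move=> x _; rewrite mulr1 -avg_shift_sq//.
    apply: le_trans (step_le_avg x (up _) qa2 _) _; first by move=> y; exact: sqr_ge0.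
    by under eq_fun do rewrite addrAC.
  rewrite stayD//; rewrite stayZ// -[n.+1]addn1 natrD mulrDl mul1r addrA.
  apply: lerD => //; rewrite -[leRHS]mulr1; apply: ler_wpM2l => //.
  exact: var_ge0.
have v0 := var_ge0 mu; have nv : 0 <= n%:R * var mu by rewrite mulr_ge0.
set S := a ^+ 2 + n%:R * var mu in H2 *.
have S0 : 0 < S by rewrite ltr_pwDl// exprn_gt0.
pose l := S / a; have l0 : 0 < l by rewrite divr_gt0.
have : stay p n (fun x => x + a) <=
    stay p n (fun x => l / 2 * 1 + (2 * l)^-1 * (x + a) ^+ 2).
  apply: stay_le => //; first by apply: quad_growthD; exact: quad_growthZ.
  move=> x _; have : 0 <= (x + a - l) ^+ 2 / (2 * l).
    by rewrite divr_ge0 ?sqr_ge0// mulr_ge0// ltW.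
  have -> : (x + a - l) ^+ 2 / (2 * l) =
      l / 2 * 1 + (2 * l)^-1 * (x + a) ^+ 2 - (x + a) by field; rewrite gt_eqF.
  lra.
rewrite [X in _ <= X -> _]stayD//; [|exact: quad_growthZ..].
rewrite !stayZ// -/(prob p n).
have : (2 * l)^-1 * stay p n (fun x => (x + a) ^+ 2) <= (2 * l)^-1 * S.
  by rewrite ler_wpM2l// invr_ge0 mulr_ge0// ltW.
have -> : (2 * l)^-1 * S = a / 2 by rewrite /l; field; rewrite !gt_eqF.
have -> : a ^+ 2 / S = a / l by rewrite /l; field; rewrite !gt_eqF.
rewrite ler_pdivrMr//; lra.
Qed.

End Barriers.

(** * Lower barriers and the two directions of (II) *)

Section LowerBarriers.
Context (R : realType) (mu : probability R R).
Context (sq_int : mu.-integrable setT (EFin \o (fun z : R => z ^+ 2))).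
Context (mean0 : avg mu id = 0) (nondeg : 0 < trunc_var mu).
Local Notation avg := (avg mu).
Local Notation stay := (stay mu).
Local Notation prob := (prob mu).
Local Notation step := (step mu).
Local Notation free := (@free R).
Local Notation sqrtn := (@sqrtn R).
Local Notation pos := (@pos R).

(** As x^+ is convex and vanishes where the walk is killed, its mean over survival never falls below
    its value at time 1. *)
Lemma prob_zero_barrier_ge : exists2 c, 0 < c & forall n, (0 < n)%N ->
  c / sqrtn n <= prob (barrier 1 (fun=> 0)) n.
Proof.
have [c c0 Hc] := stay_free_pos sq_int mean0 nondeg.
have {}Hc n : c * sqrtn n <= stay free n pos := Hc n.
set p := barrier 1 _; have up k : upward (p k) by exact: upward_barrier.
have qp := lin_quad (lin_growth_pos R).
have HW n : (0 < n)%N -> c <= stay p n pos.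
  elim: n => // -[_ _|n IHn _].
    rewrite stay_barrier_start//; last by move=> x xf; rewrite /pos max_r//; lra.
    by have := Hc 1%N; rewrite /sqrtn sqrtr1 mulr1.
  apply: (le_trans (IHn isT)); rewrite [leRHS]/=; apply: stay_le => //.
    exact: quad_growth_step.
  move=> x; rewrite /p barrierP// => px; rewrite pos_id//.
  apply: le_trans (step_ge_avg sq_int _ (up _) qp _); last first.
    by move=> y; rewrite /p barrierP// -ltNge => y0; rewrite /pos max_r//; lra.
  rewrite -[leLHS](avg_shift_id sq_int mean0); apply: le_avg => //.
  - apply: quad_growthD; first exact: quad_growth_cst.
    exact/lin_quad/lin_growth_id.
  - exact: quad_growth_shiftl.
  - by move=> z; exact: le_pos.
have [C HC] := prob_zero_barrier_le sq_int mean0 nondeg (ltn0Sn 0).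
have [D D0 HD] := stay_sq_growth sq_int mean0 up (ltn0Sn 0) HC.
exists (c ^+ 2 / D); first by rewrite divr_gt0// exprn_gt0.
move=> n n0; apply: prob_ge_of_moments => //; [exact: HW|exact: HD].
Qed.

(** Brings events with different horizons to a common final time, as [stay_harris] requires. *)
Lemma prob_trailing (p : nat -> R -> bool) n N : (n <= N)%N ->
  (forall k x, (n < k <= N)%N -> p k x) -> prob p N = prob p n.
Proof.
elim: N => [|N IHN]; first by rewrite leqn0 => /eqP ->.
rewrite leq_eqVlt => /predU1P[->//|nN] pT.
rewrite -IHN//; last by move=> k x /andP[nk kN]; apply: pT; rewrite nk leqW.
rewrite /prob /=; congr (stay _ _ _); apply/funext => x.
rewrite /step -[RHS](avg_cst mu 1); congr (avg _); apply/funext => z.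
by rewrite /cut pT ?mulr1// nN leqnn.
Qed.

Context (f : nat -> R).
Context (f_ge0 : forall n, (0 < n)%N -> 0 <= f n).
Context (f_homo : forall m n, (0 < m)%N -> (m <= n)%N -> f m <= f n).

(* If [a = f n] were much larger than [sqrt n], a walk that stays nonnegative
   up to time [n] and above [- a] up to time [a ^ 2] would be too likely. *)
Lemma barrier_le_sqrt C :
  (forall n, (0 < n)%N -> prob (barrier 1 (fun k => - f k)) n <= C / sqrtn n) ->
  exists2 G, 0 < G & forall n, (0 < n)%N -> f n <= G * sqrtn n.
Proof.
move=> HC; have [c c0 Hc] := prob_zero_barrier_ge.
set q := barrier 1 _ in HC.
have uq k : upward (q k) by exact: upward_barrier.
have v0 := var_ge0 mu.
have C0 : 0 <= C.
  have := le_trans (prob_ge0 sq_int 1 uq) (HC 1%N isT).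
  by rewrite pmulr_lge0// invr_gt0 sqrtn_gt0.
(* The 1 covers [f n <= sqrtn n]; otherwise comparing [c / sqrtn n / (1 + 2 * var mu)] with
   [C / f n] gives the second term. *)
pose G := 1 + C * (1 + 2 * var mu) / c.
have G1 : 0 <= C * (1 + 2 * var mu) / c.
  by rewrite divr_ge0 ?(ltW c0)// mulr_ge0//; lra.
exists G => [|n n0]; first by rewrite /G; lra.
have s0 := @sqrtn_gt0 R _ n0; set a := f n.
have [asn|asn] := lerP a (sqrtn n).
  by apply: (le_trans asn); apply: ler_peMl; [exact: ltW|rewrite /G; lra].
have a0 : 0 < a by exact: lt_trans asn.
have s1 : 1 <= sqrtn n by have := @sqrtn_le R _ _ n0; rewrite {1}/sqrtn sqrtr1.
have a1 : 1 <= a by lra.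
have a2 : 1 <= a ^+ 2 by nra.
(* [N <= 2 * a ^+ 2] keeps the probability of staying above [- a] bounded below, while
   [a <= sqrtn N] bounds [C / sqrtn N] by [C / a]. *)
have [N [aN Na]] : exists N : nat, a ^+ 2 <= N%:R /\ N%:R <= a ^+ 2 + 1.
  have /andP[t1 t2] := truncn_itv (sqr_ge0 a).
  by exists (Num.truncn (a ^+ 2)).+1; split; [exact: ltW|rewrite -natr1 lerD2r].
have nN : (n <= N)%N.
  rewrite -(ler_nat R) -sqrtn_sq; apply: le_trans aN.
  by rewrite lerXn2r ?nnegrE ?ltW.
have N0 := leq_trans n0 nN.
pose p (k : nat) (x : R) := (1 <= k <= n)%N ==> (0 <= x).
have up k : upward (p k).
  move=> x y xy; rewrite /p; case: (_ <= k <= _)%N => //= x0; exact: le_trans xy.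
pose pa (k : nat) (x : R) := - a <= x.
have ua k : upward (pa k) by exact: upward_ge.
have H1 : c / sqrtn n <= prob p N.
  rewrite (@prob_trailing p n)//; last first.
    by move=> k x /andP[nk _]; rewrite /p [(k <= n)%N]leqNgt nk andbF.
  apply: (le_trans (Hc n n0)); rewrite le_eqVlt; apply/orP; left; apply/eqP.
  by apply: eq_stay_barrier => k x kn; rewrite /p /barrier kn andbT.
have H2 : (1 + 2 * var mu)^-1 <= prob pa N.
  apply: le_trans (prob_constant_barrier_ge sq_int mean0 N a0).
  have Nv : 0 <= N%:R * var mu by rewrite mulr_ge0.
  have S0 : 0 < a ^+ 2 + N%:R * var mu by lra.
  have V0 : 0 < 1 + 2 * var mu by lra.
  rewrite ler_pdivlMr// mulrC ler_pdivrMr//.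
  have : N%:R * var mu <= 2 * a ^+ 2 * var mu by rewrite ler_wpM2r//; lra.
  lra.
(* Both events together imply survival above [- f]: up to [n] by nonnegativity, afterwards because
   [- f k <= - f n]. *)
have H3 : prob p N * prob pa N <= C / sqrtn N.
  apply: le_trans (HC N N0); rewrite /prob -[in leRHS](mulr1 1).
  apply: stay_harris => //; [|exact: lin_growth_cst..].
  move=> k x kN; rewrite /p /pa /q /barrier; case: k kN => //= k kN.
  case: (ltnP k n) => /= [kn x0 _|nk _ xa].
    by apply: (le_trans _ x0); rewrite oppr_le0 f_ge0.
  by apply: (le_trans _ xa); rewrite lerN2 f_homo// leqW.
have H4 : C / sqrtn N <= C / a.
  rewrite ler_wpM2l// lef_pV2 ?posrE ?sqrtn_gt0//.
  by rewrite -ler_sqr ?nnegrE ?sqrtn_ge0 ?(ltW a0)// sqrtn_sq.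
have V0 : 0 < 1 + 2 * var mu by lra.
have : c / sqrtn n * (1 + 2 * var mu)^-1 <= C / a.
  apply: le_trans H4; apply: le_trans H3; apply: ler_pM => //.
    by rewrite divr_ge0// ltW.
  by rewrite invr_ge0 ltW.
rewrite ler_pdivlMr// => H5.
have : (c / sqrtn n * (1 + 2 * var mu)^-1 * a) * ((1 + 2 * var mu) / c * sqrtn n) <=
   C * ((1 + 2 * var mu) / c * sqrtn n).
  by rewrite ler_wpM2r// mulr_ge0 ?divr_ge0// ltW.
have -> : (c / sqrtn n * (1 + 2 * var mu)^-1 * a) * ((1 + 2 * var mu) / c * sqrtn n) = a.
  by field; rewrite !gt_eqF.
rewrite /G; lra.
Qed.

(** The linear function [x + f n] is negative where the walk is killed, so killing only raises [W],
    and each displacement of the barrier adds its height times a probability bounded below by the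
    zero barrier. The upper bound on [W] uses the survival probability, the second moment and
    [barrier_le_sqrt]. *)
Lemma weights_bounded_of_lower C :
  (forall n, (0 < n)%N -> prob (barrier 1 (fun k => - f k)) n <= C / sqrtn n) ->
  exists M, forall n, \sum_(1 <= k < n) weight f k <= M.
Proof.
move=> HC; have [c c0 Hc] := prob_zero_barrier_ge.
have [G G0 HG] := barrier_le_sqrt HC.
set p := barrier 1 _ in HC.
have up k : upward (p k) by exact: upward_barrier.
have [D D0 HD] := stay_sq_growth sq_int mean0 up (ltn0Sn 0) HC.
have qs := @quad_growth_sq R; have qc := @quad_growth_cst R.
have qi : quad_growth (@id R) by exact/lin_quad/lin_growth_id.
pose W n := stay p n (fun x => x + f n).
have qW n : quad_growth (fun x => x + f n) by exact: quad_growthD.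
have W0 n : (0 < n)%N -> 0 <= W n.
  move=> n0; apply: stay_ge0 => // x; rewrite /p barrierP//; lra.
have Wstep n : (0 < n)%N -> W n + c * increment f n <= W n.+1.
  move=> n0; have s0 := @sqrtn_gt0 R _ n0.
  have D1 : 0 <= f n.+1 - f n by rewrite subr_ge0 f_homo.
  have : W n + (f n.+1 - f n) * prob p n <= W n.+1.
    rewrite /W /prob -stayZ// -stayD// [leRHS]/=; apply: stay_le => //.
    - exact: quad_growthD.
    - exact: quad_growth_step.
    - move=> x _; rewrite mulr1.
      apply: le_trans (step_ge_avg sq_int _ (up _) (qW _) _); last first.
        by move=> y; rewrite /p barrierP// -ltNge; lra.
      under [in leRHS]eq_fun do rewrite addrAC.
      by rewrite avg_shift_id//; lra.
  have : c / sqrtn n <= prob p n.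
    apply: (le_trans (Hc n n0)); apply: stay_sub => // [k|k x kn].
      exact: upward_barrier.
    rewrite /p /barrier; case: (ltnP 0 k) => //= k0 x0.
    by apply: (le_trans _ x0); rewrite oppr_le0 f_ge0.
  move=> /(ler_wpM2l D1).
  have -> : (f n.+1 - f n) * (c / sqrtn n) = c * increment f n.
    by rewrite /increment; ring.
  lra.
have WB n : (0 < n)%N -> c * \sum_(1 <= k < n) increment f k <= W n.
  elim: n => // -[_ _|n IHn _]; first by rewrite big_geq// mulr0 W0.
  rewrite big_nat_recr//= mulrDr; have := Wstep n.+1 isT; have := IHn isT; lra.
apply: (@increments_bounded_weights R f f_ge0 f_homo 1%N
  ((D / 2 + C / 2 + G * C) / c)) => // n n0.
rewrite ler_pdivlMr// mulrC; apply: (le_trans (WB n n0)).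
have s0 := @sqrtn_gt0 R _ n0.
(* AM-GM at scale sqrt n, where the second-moment term and the probability term are both bounded. *)
have : W n <= stay p n (fun x => (2 * sqrtn n)^-1 * x ^+ 2 +
    (sqrtn n / 2 + G * sqrtn n) * 1).
  apply: stay_le => //; first by apply: quad_growthD; exact: quad_growthZ.
  move=> x _; rewrite mulr1; have := HG n n0.
  have : 0 <= (x - sqrtn n) ^+ 2 / (2 * sqrtn n).
    by rewrite divr_ge0 ?sqr_ge0// mulr_ge0// ltW.
  have -> : (x - sqrtn n) ^+ 2 / (2 * sqrtn n) =
      (2 * sqrtn n)^-1 * x ^+ 2 + sqrtn n / 2 - x by field; rewrite gt_eqF.
  lra.
rewrite [X in _ <= X -> _]stayD//; [|exact: quad_growthZ..].
rewrite !stayZ// -/(prob p n).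
have : (2 * sqrtn n)^-1 * stay p n (fun x => x ^+ 2) <= (2 * sqrtn n)^-1 * (D * sqrtn n).
  by rewrite ler_wpM2l ?invr_ge0 ?mulr_ge0 ?(ltW s0)// HD.
have -> : (2 * sqrtn n)^-1 * (D * sqrtn n) = D / 2 by field; rewrite gt_eqF.
have : (sqrtn n / 2 + G * sqrtn n) * prob p n <=
    (sqrtn n / 2 + G * sqrtn n) * (C / sqrtn n).
  by rewrite ler_wpM2l ?HC// addr_ge0 ?divr_ge0 ?mulr_ge0 ?ltW.
have -> : (sqrtn n / 2 + G * sqrtn n) * (C / sqrtn n) = C / 2 + G * C.
  by field; rewrite gt_eqF.
lra.
Qed.

Lemma prob_lower_barrier_bounded M :
  (forall n, \sum_(1 <= k < n) weight f k <= M) ->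
  exists C, forall n, (0 < n)%N ->
    prob (barrier 1 (fun k => - f k)) n <= C / sqrtn n.
Proof.
move=> HM; have := @prob_lower_barrier_le R mu sq_int mean0 nondeg f f_ge0 f_homo 1 (6 * M).
apply=> // n n0; apply: le_trans (increments_le_weights f_ge0 f_homo _ n0) _ => //.
by rewrite ler_pM2l.
Qed.

End LowerBarriers.

(** * From the random variables to the law of the increments *)

Section Independence.
Context d (T : measurableType d) (R : realType) (P : probability T R).

(** The joint law is the product law by uniqueness on rectangles, and Tonelli applies. [V] has a
    general target so that it can carry the whole past. *)
Lemma integral_independent d' (T' : measurableType d') (V : {RV P >-> T'})
    (Z : {RV P >-> R}) (F : T' * R -> \bar R) :
  (forall A B, measurable A -> measurable B ->
    P (V @^-1` A `&` Z @^-1` B) = (P (V @^-1` A) * P (Z @^-1` B))%E) ->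
  measurable_fun setT F -> (forall x, (0 <= F x)%E) ->
  (\int[P]_w F (V w, Z w) = \int[P]_w \int[distribution P Z]_z F (V w, z))%E.
Proof.
move=> ind mF F0.
have mJ : measurable_fun setT (fun w => (V w, Z w)).
  by apply/measurable_fun_pairP; split; exact: measurable_funPT.
pose J : {mfun T >-> (T' * R)%type} :=
  HB.pack (fun w => (V w, Z w)) (isMeasurableFun.Build _ _ _ _ _ mJ).
have prodE X : measurable X ->
    ((distribution P V : probability T' R) \x (distribution P Z : probability R R))%E X
    = pushforward P J X.
  apply: product_measure_unique => A B mA mB.
  exact: ind.
transitivity (\int[pushforward P J]_x F x)%E.
  by rewrite ge0_integral_pushforward.
rewrite -(@eq_measure_integral _ _ _ _ (pushforward P J)
  ((distribution P V : probability T' R) \x (distribution P Z : probability R R))%E); last first.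
  by move=> A mA _; exact: prodE.
rewrite fubini_tonelli1// ge0_integral_distribution//.
- exact: measurable_fun_fubini_tonelli_F.
- by move=> x; apply: integral_ge0.
Qed.

Context (X : nat -> {RV P >-> R}) (X_indep : mutually_independent X).

(** A pi-system generating the sigma-algebra of the variables with index below [n], on which
    independence is directly available. *)
Definition past_rectangles (n : nat) : set (set T) :=
  [set A | exists2 B : nat -> set R, (forall k, measurable (B k)) &
    A = [set w | forall k, k \in iota 0 n -> B k (X k w)]].

Lemma past_rectangles_measurable n : past_rectangles n `<=` @measurable d T.
Proof.
move=> _ [B mB ->].
have -> : [set w | forall k, k \in iota 0 n -> B k (X k w)] =
    \bigcap_(k in [set k | k \in iota 0 n]) (X k @^-1` B k).
  by apply/seteqP; split.
apply: fin_bigcap_measurable => [|k _]; first exact: finite_seq.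
by rewrite -[_ @^-1` _]setTI; exact: measurable_funPT.
Qed.

Lemma past_rectangles_setI n : setI_closed (past_rectangles n).
Proof.
move=> _ _ [B mB ->] [B' mB' ->].
exists (fun k => B k `&` B' k) => [k|]; first exact: measurableI.
apply/seteqP; split => w /=.
  by move=> [h h'] k kn; split; [exact: h|exact: h'].
by move=> h; split => k /h [].
Qed.

Lemma past_rectangles_setT n : past_rectangles n setT.
Proof. by exists (fun=> setT) => //; apply/seteqP; split. Qed.

Lemma past_independent n A B : <<s past_rectangles n >> A -> measurable B ->
  P (A `&` X n @^-1` B) = (P A * P (X n @^-1` B))%E.
Proof.
move=> sA mB.
have mXB : measurable (X n @^-1` B).
  by rewrite -[_ @^-1` _]setTI; exact: measurable_funPT.
(* As a nonnegative real the constant can scale [P], so both sides are finite measures in [A] that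
   agree on the pi-system. *)
pose r : {nonneg R} := NngNum (fine_ge0 (measure_ge0 P (X n @^-1` B))).
have rE : r%:num%:E = P (X n @^-1` B) by rewrite /= fineK// fin_num_measure.
transitivity (mscale r P A); last by rewrite /mscale rE muleC.
apply: (@g_sigma_algebra_measure_unique _ R T (past_rectangles n)
  (@past_rectangles_measurable n) (fun=> setT) (fun=> past_rectangles_setT n)
  _ (mrestr P mXB) (mscale r P) (@past_rectangles_setI n)) => //.
- by rewrite bigcup_const.
- move=> _ [C mC ->]; set D := [set w | _].
  change (P (D `&` X n @^-1` B) = (r%:num%:E * P D)%E); rewrite rE muleC /D.
  have := X_indep (J := iota 0 n) (B := C) (iota_uniq _ _) mC.
  pose C' k := if k == n then B else C k.
  have mC' k : measurable (C' k) by rewrite /C'; case: eqP.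
  have := X_indep (J := iota 0 n.+1) (B := C') (iota_uniq _ _) mC'.
  rewrite -addn1 iotaD big_cat big_seq1/= add0n /C' eqxx.
  have -> : (\prod_(k <- iota 0 n) P (X k @^-1` (if k == n then B else C k)) =
      \prod_(k <- iota 0 n) P (X k @^-1` C k))%E.
    apply: eq_big_seq => k; rewrite mem_iota add0n => /andP[_ kn].
    by rewrite ltn_eqF.
  move=> E1 E2; rewrite E2 -E1; congr (P _); apply/seteqP; split => w /=.
    move=> [h hn] k; rewrite mem_cat => /orP[kn|].
      move: (kn); rewrite mem_iota add0n => /andP[_ /ltn_eqF ->]; exact: h.
    by rewrite inE => /eqP ->; rewrite eqxx.
  move=> h; split.
    move=> k kn; have := h k; rewrite mem_cat kn => /(_ isT).
    by move: kn; rewrite mem_iota add0n => /andP[_ /ltn_eqF ->].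
  by have := h n; rewrite mem_cat inE eqxx orbT => /(_ isT).
- by move=> _; apply: le_lt_trans (probability_le1 P _) (ltry 1); exact: measurableI.
Qed.

Lemma measurable_walk k : measurable_fun setT (walk X k).
Proof. by apply: measurable_sum => i; exact: measurable_funPT. Qed.

Lemma measurable_walk_past n k : (k <= n)%N ->
  @measurable_fun _ _ (g_sigma_algebraType (past_rectangles n)) R setT (walk X k).
Proof.
move=> kn; apply: measurable_sum => i _ B mB; rewrite setTI.
apply: sub_sigma_algebra.
exists (fun j : nat => if j == i :> nat then B else setT) => [j|]; first by case: eqP.
apply/seteqP; split => w /=; first by move=> Bw j _; case: eqP => // ->.
by move=> /(_ i); rewrite eqxx; apply; rewrite mem_iota/= (leq_trans (ltn_ord i)).
Qed.

Lemma measurable_past_indic n (p : nat -> R -> bool) : (forall k, upward (p k)) ->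
  @measurable_fun _ _ (g_sigma_algebraType (past_rectangles n)) R setT
    (fun w => \prod_(k < n.+1) (p k (walk X k w))%:R).
Proof.
move=> up; apply: measurable_prod => k _.
have mp : measurable_fun setT (fun x : R => (p k x)%:R : R).
  by have [] := lin_growth_indic (up k).
have kn : (k <= n)%N by rewrite -ltnS.
exact: (measurableT_comp mp (measurable_walk_past kn)).
Qed.

Context (X_ident : identically_distributed X).
Local Notation mu := (distribution P (X 0) : probability R R).
Context (sq_int : mu.-integrable setT (EFin \o (fun z : R => z ^+ 2))).

Lemma EFin_avg g : quad_growth g -> (avg mu g)%:E = (\int[mu]_z (g z)%:E)%E.
Proof.
by move=> qg; rewrite /avg /Rintegral fineK//; apply: integrable_fin_num => //;
  exact: quad_growth_integrable.
Qed.

Lemma integral_stay (p : nat -> R -> bool) n (g : R -> R) :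
  (forall k, upward (p k)) -> quad_growth g -> (forall x, 0 <= g x) ->
  (\int[P]_w ((\prod_(k < n.+1) (p k (walk X k w))%:R) * g (walk X n w))%:E)%E =
  (stay mu p n g)%:E.
Proof.
move=> up; elim: n g => [|n IHn] g qg g0.
  under eq_integral do rewrite big_ord1 /walk big_ord0.
  by rewrite integral_cst//= [X in (_ * X)%E]probability_setT mule1.
have qG := quad_growth_cut (up n.+1) qg.
have G0 := @cut_ge0 R (p n.+1) g g0.
(* The past is the identity map from [T] to [T] with the coarser sigma-algebra: a single variable
   that determines the walk up to time [n] and is independent of [X n]. *)
pose T' := g_sigma_algebraType (past_rectangles n).
pose F (x : T' * R) := (\prod_(k < n.+1) (p k (walk X k x.1))%:R *
  cut (p n.+1) g (walk X n x.1 + x.2))%:E.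
have mV : @measurable_fun _ _ T T' setT id.
  have sub := smallest_sub (@sigma_algebra_measurable _ T)
    (@past_rectangles_measurable n).
  by move=> _ A sA; rewrite setTI; apply: sub.
pose V : {mfun T >-> T'} := HB.pack (id : T -> T')
  (isMeasurableFun.Build _ _ _ _ (id : T -> T') mV).
have prod0 w : 0 <= \prod_(k < n.+1) (p k (walk X k w))%:R :> R by apply: prodr_ge0.
have F0 x : (0 <= F x)%E by rewrite lee_fin mulr_ge0.
have mF : measurable_fun setT F.
  have mI := measurableT_comp (@measurable_past_indic n p up) (@measurable_fst _ _ T' R).
  have mS := measurableT_comp (@measurable_walk_past n n (leqnn _)) (@measurable_fst _ _ T' R).
  apply/measurable_EFinP; apply: measurable_funM; first exact: mI.
  apply: measurableT_comp; first by have [] := qG.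
  apply: measurable_funD => //.
transitivity (\int[P]_w F (V w, X n w))%E.
  apply: eq_integral => w _; rewrite /F /= big_ord_recr/= -mulrA /cut.
  by have -> : walk X n.+1 w = walk X n w + X n w by rewrite /walk big_ord_recr.
rewrite (integral_independent (V := V) (Z := X n)) //; last first.
  by move=> A B mA mB; exact: past_independent.
rewrite [RHS]/= -IHn; [|exact: quad_growth_step|by move=> x; exact: avg_ge0].
apply: eq_integral => w _; rewrite /F /=.
rewrite (@eq_measure_integral _ _ _ _ mu (distribution P (X n))); last first.
  by move=> A mA _; exact: X_ident.
under eq_integral do rewrite EFinM.
rewrite ge0_integralZl_EFin//; last 2 first.
- by move=> z _; rewrite lee_fin.
- by apply/measurable_EFinP; have [] := quad_growth_shiftl (walk X n w) qG.
by rewrite -EFin_avg//; exact: quad_growth_shiftl.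
Qed.

Lemma probability_barrier n0 (b : nat -> R) n :
  P [set w | forall k, (n0 <= k <= n)%N -> b k <= walk X k w] =
  (prob mu (barrier n0 b) n)%:E.
Proof.
set D := [set w | _].
have mD : measurable D.
  have -> : D = \bigcap_(k in [set k | (n0 <= k <= n)%N])
      (walk X k @^-1` [set` `[b k, +oo[]).
    by apply/seteqP; split => w /= H k /H; rewrite /= in_itv/= andbT.
  apply: fin_bigcap_measurable => [|k _].
    by apply: (sub_finite_set _ (finite_II n.+1)) => k /= /andP[].
  by rewrite -[_ @^-1` _]setTI; exact: measurable_walk.
rewrite -[in LHS](setIT D) -integral_indic// -integral_stay//; last 2 first.
- by move=> k; exact: upward_barrier.
- exact: quad_growth_cst.
apply: eq_integral => w _; rewrite mulr1 indicE; congr (_%:E).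
case: (boolP (w \in D)); rewrite ?inE ?notin_setE => Dw.
  rewrite big1// => k _; rewrite /barrier; case: (leqP n0 k) => //= n0k.
  by rewrite Dw// n0k -ltnS ltn_ord.
apply/esym/eqP/prodf_eq0; apply: contra_notP Dw => H k /andP[n0k kn].
have := H; apply: contra_notP => /negP Hk.
exists (Ordinal (kn : (k < n.+1)%N)) => //=.
by rewrite /barrier n0k /= (negbTE Hk).
Qed.

End Independence.

(** * Moments and nondegeneracy of the law of one increment *)

Section IncrementLaw.
Context d (T : measurableType d) (R : realType) (P : probability T R).
Context (Y : {RV P >-> R}).
Context (Y_int : P.-integrable [set: T] (EFin \o Y)).
Context (Y_mean : ('E_P[Y] = 0)%E).
Local Notation mu := (distribution P Y : probability R R).

Lemma avg_id_eq0 : avg mu id = 0.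
Proof.
rewrite /avg /Rintegral integral_distribution//.
- by have := Y_mean; rewrite expectation_def /comp => ->.
Qed.

Lemma law_sq_integrable : ('V_P[Y] < +oo)%E ->
  mu.-integrable setT (EFin \o (fun z : R => z ^+ 2)).
Proof.
rewrite /variance covariance.unlock Y_mean expectation_def/= => H.
apply/integrableP; split.
  by apply/measurable_EFinP; exact: measurable_funX.
apply: le_lt_trans H.
rewrite ge0_integral_distribution//; last first.
  by apply: measurableT_comp => //; apply/measurable_EFinP; exact: measurable_funX.
rewrite le_eqVlt; apply/orP; left; apply/eqP; apply: eq_integral => w _ /=.
by rewrite ger0_norm ?sqr_ge0// !subr0 expr2.
Qed.

(** A nonnegative function with zero integral vanishes almost everywhere, so a zero truncated moment
    would force [Y] to be almost everywhere 0. *)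
Lemma trunc_var_gt0 : ('V_P[Y] < +oo)%E -> nondegenerate_rv Y -> 0 < trunc_var mu.
Proof.
move=> /law_sq_integrable sq_int nd.
have m0 z : 0 <= Num.min (z ^+ 2) 1 :> R by rewrite le_min sqr_ge0/=.
have mm : measurable_fun setT (fun z : R => Num.min (z ^+ 2) 1).
  by apply: measurable_minr => //; exact: measurable_funX.
rewrite lt_neqAle eq_sym avg_ge0// andbT; apply/eqP => tv0; apply: nd; exists 0.
have I0 : (\int[P]_w (Num.min (Y w ^+ 2) 1)%:E = 0)%E.
  transitivity (\int[mu]_z (Num.min (z ^+ 2) 1)%:E)%E.
    by rewrite ge0_integral_distribution//; exact/measurable_EFinP.
  rewrite -[LHS]fineK; first by have := tv0; rewrite /trunc_var /avg /Rintegral => ->.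
  exact: integrable_fin_num (quad_growth_integrable sq_int (trunc_var_growth R)).
have mY : measurable_fun setT (fun w => (Num.min (Y w ^+ 2) 1)%:E).
  apply/measurable_EFinP.
  exact: (measurableT_comp mm (measurable_funPT Y)).
have [+ _] := ae_eq_integral_abs P measurableT mY.
have -> : (\int[P]_w `|(Num.min (Y w ^+ 2) 1)%:E|)%E = 0%E.
  by rewrite -I0; apply: eq_integral => w _; rewrite gee0_abs// lee_fin.
move=> /(_ erefl); apply: filterS => w /(_ I) [].
rewrite /Num.min; case: ifP => _ /eqP; last by rewrite oner_eq0.
by rewrite sqrf_eq0 => /eqP.
Qed.

End IncrementLaw.

Lemma powR_weight (R : realType) (f : nat -> R) n : (0 < n)%N ->
  (n%:R `^ (- (3 / 2)) * f n)%R = weight f n.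
Proof.
move=> n0; rewrite /weight mulrC powRN; congr (_ / _).
rewrite (_ : 3 / 2 = 2^-1 * 3%:R); last by rewrite mulrC.
by rewrite powRrM powR12_sqrt// powR_mulrn ?sqrtr_ge0.
Qed.

Local Open Scope ereal_scope.

Theorem theorem3p2 (d : measure_display) (T : measurableType d)
    (R : realType) (P : probability T R) (X : nat -> {RV P >-> R})
    (f : nat -> R)
    (X_iid : iid X)
    (X_nondeg : forall k, nondegenerate_rv (X k))
    (X_int : forall k, P.-integrable [set: T] (EFin \o X k))
    (X_mean : forall k, 'E_P[X k] = 0)
    (X_var : forall k, 'V_P[X k] < +oo)
    (f_incr : positive_increasing f) :
  (\sum_(1 <= n <oo) (n%:R `^ (- (3 / 2)) * f n)%R%:E < +oo <->
   exists nf : nat, (1 <= nf)%N /\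
     0 < ereal_inf [set (Num.sqrt n%:R)%:E *
           P [set w | forall k, (nf <= k <= n)%N -> (f k <= walk X k w)%R]
         | n in [set n : nat | (nf <= n)%N]])
  /\
  (\sum_(1 <= n <oo) (n%:R `^ (- (3 / 2)) * f n)%R%:E < +oo <->
   ereal_sup [set (Num.sqrt n%:R)%:E *
       P [set w | forall k, (1 <= k <= n)%N -> (- f k <= walk X k w)%R]
     | n in [set n : nat | (1 <= n)%N]] < +oo).
Proof.
have [X_indep X_ident] := X_iid; have [f_gt0 f_homo] := f_incr.
have f_ge0 n : (0 < n)%N -> (0 <= f n)%R by move=> /f_gt0 /ltW.
have sq_int := law_sq_integrable (X_mean 0%N) (X_var 0%N).
have mean0 := avg_id_eq0 (X_int 0%N) (X_mean 0%N).
have nondeg := trunc_var_gt0 (X_mean 0%N) (X_var 0%N) (X_nondeg 0%N).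
set mu := (distribution P (X 0%N) : probability R R) in sq_int mean0 nondeg.
have probE := probability_barrier X_indep X_ident sq_int.
have seriesP : \sum_(1 <= n <oo) (n%:R `^ (- (3 / 2)) * f n)%R%:E < +oo <->
    exists M, forall n, (\sum_(1 <= k < n) weight f k <= M)%R.
  have t0 n : (0 < n)%N -> (0 <= n%:R `^ (- (3 / 2)) * f n)%R.
    by move=> n0; rewrite powR_weight// weight_ge0.
  apply: (iff_trans (nneseries_ltyP t0)).
  have sumE n : (\sum_(1 <= k < n) (k%:R `^ (- (3 / 2)) * f k) =
      \sum_(1 <= k < n) weight f k)%R.
    by apply: eq_big_nat => k /andP[k0 _]; exact: powR_weight.
  by split=> -[M HM]; exists M => n; have := HM n; rewrite sumE.
split; apply: (iff_trans seriesP); split.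
- move=> [M HM].
  have [n0 [c [n00 c0 Hc]]] := prob_upper_barrier_ge sq_int mean0 nondeg f_ge0 f_homo HM.
  exists n0; split => //; apply: (@lt_le_trans _ _ c%:E); first by rewrite lte_fin.
  apply: le_ereal_inf_tmp => _ [n /= nn0 <-]; rewrite probE -EFinM lee_fin.
  have s0 := @sqrtn_gt0 R n (leq_trans n00 nn0).
  by rewrite mulrC -ler_pdivrMr//; exact: Hc.
- move=> [n0 [n00]]; set S := (X in ereal_inf X) => inf0.
  have infS n : (n0 <= n)%N -> ereal_inf S <= (sqrtn R n * prob mu (barrier n0 f) n)%:E.
    by move=> nn0; apply: ereal_inf_lbound; exists n => //=; rewrite probE EFinM.
  (* Needed before [fine], which sends infinite values to 0; the term at [n0] bounds the infimum
     from above. *)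
  have fin : ereal_inf S \is a fin_num.
    rewrite fin_numE; apply/andP; split; first by rewrite gt_eqF// (lt_trans _ inf0)// ltNyr.
    by rewrite lt_eqF// (le_lt_trans (infS n0 (leqnn _)))// ltry.
  have c0 : (0 < fine (ereal_inf S))%R by rewrite -lte_fin fineK.
  apply: (weights_bounded_of_upper sq_int mean0 nondeg f_ge0 f_homo n00 c0) => n nn0.
  have s0 := @sqrtn_gt0 R n (leq_trans n00 nn0).
  by rewrite ler_pdivrMr// mulrC -lee_fin fineK//; exact: infS.
- move=> [M HM].
  have [C HC] := prob_lower_barrier_bounded sq_int mean0 nondeg f_ge0 f_homo HM.
  apply: (@le_lt_trans _ _ C%:E); last exact: ltry.
  apply: ge_ereal_sup => _ [n /= n0 <-].
  rewrite (probE 1%N (fun k => - f k)%R) -EFinM lee_fin.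
  have s0 := @sqrtn_gt0 R n n0.
  by rewrite mulrC -ler_pdivlMr//; exact: HC.
- set S := (X in ereal_sup X) => supoo.
  have supS n : (0 < n)%N ->
      (sqrtn R n * prob mu (barrier 1 (fun k => - f k)%R) n)%:E <= ereal_sup S.
    move=> n0; apply: ereal_sup_ubound; exists n => //=.
    by rewrite (probE 1%N (fun k => - f k)%R) EFinM.
  have fin : ereal_sup S \is a fin_num.
    rewrite fin_numE; apply/andP; split; last by rewrite lt_eqF.
    by rewrite gt_eqF// (lt_le_trans _ (supS 1%N isT))// ltNyr.
  apply: (@weights_bounded_of_lower R mu sq_int mean0 nondeg f f_ge0 f_homo
    (fine (ereal_sup S))) => n n0.
  have s0 := @sqrtn_gt0 R n n0.
  by rewrite ler_pdivlMr// mulrC -lee_fin fineK//; exact: supS.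
Qed.
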